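(* Assume there are constants $K_{\partial\Omega,\Omega},L_{\partial\Omega,\Omega},K_1,K_2$ such that for all $f\in C^1(\Omega)$ $$\mathrm{Var}_{\lambda_{\partial\Omega}}(f)\le K_{\partial\Omega,\Omega}\int_\Omega|\nabla f|^2\,d\lambda_\Omega,\qquad \mathrm{Ent}_{\lambda_{\partial\Omega}}(f^2)\le L_{\partial\Omega,\Omega}\int_\Omega|\nabla f|^2\,d\lambda_\Omega,$$ $$\Bigl(\int_\Omega f\,d\lambda_\Omega-\int_{\partial\Omega}f\,d\lambda_{\partial\Omega}\Bigr)^2\le K_1\int_\Omega|\nabla f|^2\,d\lambda_\Omega+K_2\int_{\partial\Omega}|\nabla^\tau f|^2\,d\lambda_{\partial\Omega}.$$ Then for every $\alpha\in(0,1)$ $$L_\alpha\le\inf_{s,t\in[0,1]}\max\Bigl\{L_\Omega+\frac{1-\alpha}{\alpha}sL_{\partial\Omega,\Omega}+\frac{(1-\alpha)(\log\alpha-\log(1-\alpha))}{2\alpha-1}\bigl(C_\Omega+tK_{\partial\Omega,\Omega}+K_1\bigr),$$ $$\qquad\qquad(1-s)L_{\partial\Omega}+\frac{\alpha(\log\alpha-\log(1-\alpha))}{2\alpha-1}\bigl((1-t)C_{\partial\Omega}+K_2\bigr)\Bigr\}.$$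
   Context: $\Omega$ is a smooth compact connected Riemannian manifold of dimension $d\ge2$ with smooth connected boundary $\partial\Omega$. $\lambda_\Omega$ and $\lambda_{\partial\Omega}$ are the normalised volume measure on $\Omega$ and the normalised $(d-1)$-dimensional Hausdorff measure on $\partial\Omega$; $\nabla^\tau$ is the tangential gradient on $\partial\Omega$. For $\alpha\in(0,1)$, $\lambda_\alpha=\alpha\lambda_\Omega+(1-\alpha)\lambda_{\partial\Omega}$ and $\mathcal E_\alpha(f)=\alpha\int_\Omega|\nabla f|^2d\lambda_\Omega+(1-\alpha)\int_{\partial\Omega}|\nabla^\tau f|^2d\lambda_{\partial\Omega}$. $\mathrm{Var}_\mu(f)=\int f^2d\mu-(\int f\,d\mu)^2$ and $\mathrm{Ent}_\mu(f^2)=\int f^2\log(f^2)\,d\mu-\bigl(\int f^2d\mu\bigr)\log\bigl(\int f^2d\mu\bigr)$. $L_\alpha$ is the optimal constant with $\mathrm{Ent}_{\lambda_\alpha}(f^2)\le L_\alpha\mathcal E_\alpha(f)$ for all $f\in C^1(\Omega)$. $C_\Omega$, $L_\Omega$ are the optimal constants in $\mathrm{Var}_{\lambda_\Omega}(f)\le C_\Omega\int_\Omega|\nabla f|^2d\lambda_\Omega$ and $\mathrm{Ent}_{\lambda_\Omega}(f^2)\le L_\Omega\int_\Omega|\nabla f|^2d\lambda_\Omega$, $f\in C^1(\Omega)$ (Neumann Poincaré and logarithmic Sobolev constants of $\Omega$); $C_{\partial\Omega}$, $L_{\partial\Omega}$ are the optimal constants in $\mathrm{Var}_{\lambda_{\partial\Omega}}(f)\le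 C_{\partial\Omega}\int_{\partial\Omega}|\nabla^\tau f|^2d\lambda_{\partial\Omega}$ and $\mathrm{Ent}_{\lambda_{\partial\Omega}}(f^2)\le L_{\partial\Omega}\int_{\partial\Omega}|\nabla^\tau f|^2d\lambda_{\partial\Omega}$. At $\alpha=1/2$ the quotient $\frac{\log\alpha-\log(1-\alpha)}{2\alpha-1}$ is understood as its limit $2$. *)

(* Defs.v *)
From HB Require Import structures.
From mathcomp Require Import all_boot all_order all_algebra.
From mathcomp Require Import all_classical all_reals all_analysis.
Set Implicit Arguments.
Unset Strict Implicit.
Unset Printing Implicit Defensive.
Import Order.TTheory GRing.Theory Num.Theory.
Import numFieldNormedType.Exports.
Local Open Scope classical_set_scope.
Local Open Scope ring_scope.

Section calculus_on_half_space.
Context {R : realType}.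

Definition basis_vec {n} (j : 'I_n) : 'rV[R]_n := delta_mx 0 j.

(* [Ck k V f]: f is of class C^k on the open set V. *)
Fixpoint Ck {n} (k : nat) (V : set 'rV[R]_n) (f : 'rV[R]_n -> R) : Prop :=
  (forall x, V x -> {for x, continuous f}) /\
  match k with
  | 0 => True
  | k'.+1 => forall j : 'I_n,
      (forall x, V x -> derivable f x (basis_vec j)) /\
      Ck k' V (fun x => 'D_(basis_vec j) f x)
  end.

Definition smooth_on {n} (V : set 'rV[R]_n) (f : 'rV[R]_n -> R) : Prop :=
  forall k, Ck k V f.

Definition C1_on {n} : set 'rV[R]_n -> ('rV[R]_n -> R) -> Prop := Ck 1.

Definition half_space {n} : set 'rV[R]_n.+1 := [set x | 0 <= x 0 0].

(* Regularity on a relatively open subset W of the half-space, in the usual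
   sense: near every point of W, f extends to a function that is regular on an
   open subset of the whole space. *)
Definition locally_extends {n}
    (P : set 'rV[R]_n -> ('rV[R]_n -> R) -> Prop)
    (W : set 'rV[R]_n) (f : 'rV[R]_n -> R) : Prop :=
  forall x, W x -> exists (V : set 'rV[R]_n) (g : 'rV[R]_n -> R),
    [/\ open V, V x, P V g & forall y, V y -> W y -> g y = f y].

(* Right partial derivative. For j = 0 this is the one-sided derivative
   pointing into the half-space, so it makes sense up to the boundary; for
   f in C^1 it is the j-th partial derivative of any local C^1 extension. *)
Definition partial {n} (j : 'I_n) (f : 'rV[R]_n -> R) (x : 'rV[R]_n) : R :=
  lim (h^-1 * (f (x + h *: basis_vec j) - f x) @[h --> 0^'+]).

(* Iterated one-dimensional Lebesgue integrals. This is only applied to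
   bounded, compactly supported functions that are continuous on the closed
   half-space and vanish off it, for which it is the Lebesgue integral on
   R^n. *)
Fixpoint iterated_integral (n : nat) : ('rV[R]_n -> R) -> R :=
  match n with
  | 0 => fun F => F 0
  | n'.+1 => fun F => \int[lebesgue_measure]_t
      iterated_integral (fun y : 'rV[R]_n' => F (row_mx (t%:M : 'rV[R]_1) y))
  end.

End calculus_on_half_space.

(* Smooth Riemannian manifolds with (possibly empty) boundary, of dimension
   n.+1: an atlas of charts into the half-space, together with the matrix of
   the metric in every chart. Tangent vectors are row vectors. *)
Record riemannian_manifold (R : realType) (n : nat) (M : ptopologicalType) := {
  chart : Type;
  dom : chart -> set M;
  phi : chart -> M -> 'rV[R]_n.+1;
  phi_inv : chart -> 'rV[R]_n.+1 -> M;
  chart_at : M -> chart;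
  metric : chart -> 'rV[R]_n.+1 -> 'M[R]_n.+1;
  manifold_hausdorff : hausdorff_space M;
  manifold_second_countable : @second_countable M;
  chart_atP : forall p, dom (chart_at p) p;
  dom_open : forall i, open (dom i);
  chart_image : forall i, exists2 V : set 'rV[R]_n.+1,
    open V & phi i @` dom i = V `&` half_space;
  phiK : forall i p, dom i p -> phi_inv i (phi i p) = p;
  phi_continuous : forall i p, dom i p -> {for p, continuous (phi i)};
  phi_inv_continuous : forall i,
    {within phi i @` dom i, continuous (phi_inv i)};
  transition_smooth : forall i j (b : 'I_n.+1),
    locally_extends smooth_on (phi i @` (dom i `&` dom j))
      (fun x => phi j (phi_inv i x) 0 b);
  (* invariance of the boundary: being a boundary point does not depend on the
     chart; this is a consequence of the other fields *)
  boundary_invariant : forall i j p, dom i p -> dom j p ->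
    phi i p 0 0 = 0 -> phi j p 0 0 = 0;
  metric_smooth : forall i (a b : 'I_n.+1),
    locally_extends smooth_on (phi i @` dom i) (fun x => metric i x a b);
  metric_sym : forall i p, dom i p ->
    (metric i (phi i p))^T = metric i (phi i p);
  metric_pos : forall i p (v : 'rV[R]_n.+1), dom i p -> v != 0 ->
    0 < (v *m metric i (phi i p) *m v^T) 0 0;
  metric_transition : forall i j p, dom i p -> dom j p ->
    let J := \matrix_(a, b)
      partial a (fun x => phi j (phi_inv i x) 0 b) (phi i p) in
    metric i (phi i p) = J *m metric j (phi j p) *m J^T
}.

Arguments dom {R n M} r _.
Arguments phi {R n M} r _ _.
Arguments phi_inv {R n M} r _ _.
Arguments metric {R n M} r _ _.
Arguments chart_at {R n M} r _.

(* M with its Borel sigma-algebra *)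
Notation borel M := (g_sigma_algebraType (@open M)).

Section riemannian_notions.
Context {R : realType} {n : nat} {M : ptopologicalType}.
Variable X : riemannian_manifold R n M.

Definition boundary : set M :=
  [set p | phi X (chart_at X p) p 0 0 = 0].

Definition C1 (f : M -> R) : Prop :=
  forall i, locally_extends C1_on (phi X i @` dom X i)
    (fun x => f (phi_inv X i x)).

Definition metric_at (p : M) : 'M[R]_n.+1 :=
  metric X (chart_at X p) (phi X (chart_at X p) p).

Definition differential (f : M -> R) (p : M) : 'rV[R]_n.+1 :=
  \row_j partial j (fun x => f (phi_inv X (chart_at X p) x))
    (phi X (chart_at X p) p).

Definition gradient (f : M -> R) (p : M) : 'rV[R]_n.+1 :=
  differential f p *m invmx (metric_at p).

Definition sqnorm {k} (G : 'M[R]_k) (v : 'rV[R]_k) : R := (v *m G *m v^T) 0 0.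

Definition sqgrad (f : M -> R) (p : M) : R := sqnorm (metric_at p) (gradient f p).

(* Functions on the boundary are represented by functions on M, whose values
   off the boundary are irrelevant below. In a chart the boundary is the
   hyperplane of vanishing 0-th coordinate. [C1_boundary] asks that the chart
   expression be C^1 in the remaining coordinates, by composing it with the
   projection onto that hyperplane. *)
Definition flatten0 (y : 'rV[R]_n.+1) : 'rV[R]_n.+1 :=
  \row_j (if j == 0 then 0 else y 0 j).

Definition C1_boundary (f : M -> R) : Prop :=
  forall i, C1_on (flatten0 @^-1` (phi X i @` dom X i))
    (fun y => f (phi_inv X i (flatten0 y))).

(* The induced metric and the gradient on the boundary, in the coordinates
   1, ..., n of the chart. *)
Definition boundary_metric_at (p : M) : 'M[R]_n :=
  row' 0 (col' 0 (metric_at p)).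

Definition tangential_differential (f : M -> R) (p : M) : 'rV[R]_n :=
  col' 0 (differential f p).

Definition tangential_gradient (f : M -> R) (p : M) : 'rV[R]_n :=
  tangential_differential f p *m invmx (boundary_metric_at p).

Definition sqgrad_tau (f : M -> R) (p : M) : R :=
  sqnorm (boundary_metric_at p) (tangential_gradient f p).

(* The Riemannian volume measure: it has density sqrt (det g) in every chart,
   tested on nonnegative continuous functions supported in the chart. *)
Definition is_riemannian_volume (vol : {measure set (borel M) -> \bar R}) :=
  forall i (f : M -> R), continuous f -> (forall p, 0 <= f p) ->
    compact (closure [set p | f p != 0]) ->
    closure [set p | f p != 0] `<=` dom X i ->
    (\int[vol]_p (f p)%:E =
      (iterated_integral (fun x =>
        if x \in phi X i @` dom X i
        then f (phi_inv X i x) * Num.sqrt (\det (metric X i x))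
        else 0))%:E)%E.

(* Piecewise C^1 curves on [0, 1], with finitely many corners S. *)
Definition coord (c : R -> M) (t : R) (k : 'I_n.+1) (s : R) : R :=
  phi X (chart_at X (c t)) (c s) 0 k.

Definition piecewise_C1 (c : R -> M) : Prop :=
  {within `[0, 1], continuous c} /\
  exists S : seq R, forall t, 0 < t < 1 -> t \notin S ->
    forall k, derivable (coord c t k) t 1 /\
      {for t, continuous (derive1 (coord c t k))}.

Definition speed (c : R -> M) (t : R) : R :=
  Num.sqrt (sqnorm (metric_at (c t)) (\row_k derive1 (coord c t k) t)).

Definition curve_length (c : R -> M) : \bar R :=
  (\int[lebesgue_measure]_(t in `[0%R, 1%R]) (speed c t)%:E)%E.

Definition riemannian_dist (p q : M) : \bar R :=
  ereal_inf (curve_length @`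
    [set c | [/\ piecewise_C1 c, c 0 = p & c 1 = q]]).

Local Open Scope ereal_scope.

(* maxe 0 makes the diameter of the empty set 0 *)
Definition diam (A : set M) : \bar R :=
  maxe 0 (ereal_sup [set riemannian_dist p q | p in A & q in A]).

(* The s-dimensional Hausdorff measure, up to its dimensional constant, which
   is immaterial after normalisation. *)
Definition hausdorff_measure (s : nat) (A : set M) : \bar R :=
  ereal_sup [set ereal_inf
      [set \sum_(0 <= k <oo) diam (C k) ^+ s | C in
        [set C : nat -> set M | A `<=` \bigcup_k C k /\
          forall k, diam (C k) <= delta%:E]]
    | delta in [set delta : R | (0 < delta)%R]].

(* P is the set function nu normalised to have total mass 1 on D. *)
Definition normalised_on (D : set M) (P : probability (borel M) R)
    (nu : set M -> \bar R) : Prop :=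
  exists2 c : R, (0 < c)%R &
    forall A : set (borel M), measurable A -> P A = c%:E * nu (A `&` D).

Definition is_normalised_volume (P : probability (borel M) R) : Prop :=
  exists2 vol : {measure set (borel M) -> \bar R},
    is_riemannian_volume vol & normalised_on setT P vol.

(* the (d-1)-dimensional Hausdorff measure, where d = n.+1 *)
Definition is_normalised_boundary_measure (P : probability (borel M) R) : Prop :=
  normalised_on boundary P (hausdorff_measure n).

End riemannian_notions.

Section functional_inequalities.
Context {d} {T : measurableType d} {R : realType}.
Implicit Types (mu : {measure set T -> \bar R}) (D : set T) (f g : T -> R).

Definition Var mu D f : R :=
  \int[mu]_(x in D) (f x ^+ 2) - (\int[mu]_(x in D) f x) ^+ 2.

(* The library's convention ln 0 = 0 gives 0 log 0 = 0. *)
Definition Ent mu D g : R :=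
  \int[mu]_(x in D) (g x * ln (g x)) -
  (\int[mu]_(x in D) g x) * ln (\int[mu]_(x in D) g x).

(* The infimum (+oo if there is none) of the constants c with Phi <= c E on
   the class C of functions. *)
Definition optimal_constant (C : set (T -> R)) (Phi E : (T -> R) -> R) : \bar R :=
  ereal_inf (EFin @` [set c : R | forall f, C f -> Phi f <= c * E f]).

Definition mixture (a : R) (a0 : 0 < a) (a1 : a < 1)
    (mu nu : {measure set T -> \bar R}) : {measure set T -> \bar R} :=
  measure_add (mscale (NngNum (ltW a0)) mu)
    (mscale (NngNum (ltW (etrans (subr_gt0 a 1) a1))) nu).

End functional_inequalities.

Section constants.
Context {R : realType} {n : nat} {M : ptopologicalType}.
Variables (X : riemannian_manifold R n M) (lamO lamB : probability (borel M) R).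

Definition energy (f : M -> R) : R := \int[lamO]_p sqgrad X f p.

Definition energy_tau (f : M -> R) : R :=
  \int[lamB]_(p in boundary X) sqgrad_tau X f p.

Definition C_Omega : \bar R :=
  optimal_constant (C1 X : set (borel M -> R)) (Var lamO setT) energy.

Definition L_Omega : \bar R :=
  optimal_constant (C1 X : set (borel M -> R))
    (fun f => Ent lamO setT (fun p => f p ^+ 2)) energy.

Definition C_boundary : \bar R :=
  optimal_constant (C1_boundary X : set (borel M -> R))
    (Var lamB (boundary X)) energy_tau.

Definition L_boundary : \bar R :=
  optimal_constant (C1_boundary X : set (borel M -> R))
    (fun f => Ent lamB (boundary X) (fun p => f p ^+ 2)) energy_tau.

Definition energy_alpha (a : R) (f : M -> R) : R :=
  a * energy f + (1 - a) * energy_tau f.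

Definition L_alpha (a : R) (a0 : 0 < a) (a1 : a < 1) : \bar R :=
  optimal_constant (C1 X : set (borel M -> R))
    (fun f => Ent (mixture a0 a1 lamO lamB) setT (fun p => f p ^+ 2))
    (energy_alpha a).

End constants.

Definition log_quotient {R : realType} (a : R) : R :=
  if a == 2^-1 then 2 else (ln a - ln (1 - a)) / (2 * a - 1).

(* Main.v *)
Require Import Defs.
From HB Require Import structures.
From mathcomp Require Import all_boot all_order all_algebra.
From mathcomp Require Import all_classical all_reals all_analysis.
From mathcomp Require Import measurable_realfun.
From mathcomp Require Import ring lra.
Set Implicit Arguments.
Unset Strict Implicit.
Unset Printing Implicit Defensive.
Import Order.TTheory GRing.Theory Num.Theory.
Import numFieldNormedType.Exports.
Local Open Scope classical_set_scope.
Local Open Scope ring_scope.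

(** Write [m1], [m2] for the two measures, [b = 1 - a], [A] and [B] for the
integrals of [f ^+ 2] against them, and [E1], [E2] for the two energies. The
entropy of a mixture splits exactly as
[[
  Ent(f^2) = a Ent_m1(f^2) + b Ent_m2(f^2) + (entropy of a two-point space),
]]
where the two-point space has weights [a], [b] and carries the values [A], [B].
The logarithmic Sobolev inequality of the two-point space, whose sharp constant
is [a * b * log_quotient a], bounds the last term by
[a * b * log_quotient a * (sqrt A - sqrt B) ^+ 2]
([two_point_log_sobolev]). Since [sqrt A] is the Euclidean norm of the pair
(mean, standard deviation) of [f] under [m1], the triangle inequality in the
plane bounds [(sqrt A - sqrt B) ^+ 2] by the sum of both variances and of the
squared difference of the means ([sqrt_moment_gap]). Together these give
[Ent_mixture_le]. Each term is then controlled by a hypothesis or by an optimal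
constant: the entropy and the variance under [m2] are each written as a convex
combination, with parameters [s] and [t], so that one part is paid for by [E1]
and the other by [E2]. Collecting the coefficients of [a * E1] and [b * E2]
gives the two arguments of the maximum.

The two-point inequality. Normalise the mean square to one, let [p], [q] be the
shares of the two points in it and [H p] the Shannon entropy of [(p, q)]. After
expansion the inequality says that [H p] lies above its tangent at [p = a],
when [H] is seen as a function of [sqrt (p * q)]; so it expresses a convexity.
In the variable [z = sqrt (p / q)], [H] and [sqrt (p * q)] become
[entropy_odds z] and [balance_odds z], and the convexity reduces to the fact
that [ln z / (z - z^-1)] is nonincreasing on [z >= 1]
([entropy_odds_tangent]). The case where one of the two values vanishes follows
by a limit.

Infinite constants. The optimal constants are extended reals, and the sum of
[-oo] and [+oo] is [-oo], so the bound could fail if a Poincare constant and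
the matching logarithmic Sobolev constant were infinite with opposite signs.
This does not happen. A logarithmic Sobolev inequality implies the Poincare
inequality with the same constant, since [Var f <= Ent ((f + k) ^+ 2)] as soon
as [f + k >= 1] ([poincare_of_log_sobolev]). Conversely, a Poincare constant
[-oo] forces all variances to vanish, hence all entropies
([log_sobolev_degenerate]).

Geometry enters only through a few facts: the boundary is closed and carries
the full mass of its measure, functions of class C^1 are continuous, hence
bounded and Borel on the compact manifold and on its boundary, their restriction
to the boundary is again of class C^1, and the energies are nonnegative and
invariant under the addition of constants. *)

(** * The two-point logarithmic Sobolev inequality *)

Section two_point_inequality.
Context {R : realType}.
Implicit Types a b c k x y z : R.

(** The rules of differentiation, for functions written pointwise, so that they
apply syntactically to an explicit formula. *)
Lemma derives_const a x : is_derive x 1 (fun=> a) (0 : R).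
Proof. exact: is_derive_cst. Qed.

Lemma derives_var x : is_derive x 1 (fun y : R => y) (1 : R).
Proof. exact: is_derive_id. Qed.

Lemma derives_add (f g : R -> R) x df dg :
  is_derive x 1 f df -> is_derive x 1 g dg ->
  is_derive x 1 (fun y => f y + g y) (df + dg).
Proof. by move=> hf hg; exact: is_deriveD. Qed.

Lemma derives_opp (f : R -> R) x df :
  is_derive x 1 f df -> is_derive x 1 (fun y => - f y) (- df).
Proof. by move=> hf; exact: is_deriveN. Qed.

Lemma derives_mul (f g : R -> R) x df dg :
  is_derive x 1 f df -> is_derive x 1 g dg ->
  is_derive x 1 (fun y => f y * g y) (f x * dg + g x * df).
Proof. by move=> hf hg; exact: is_deriveM. Qed.

Lemma derives_sqr (f : R -> R) x df :
  is_derive x 1 f df -> is_derive x 1 (fun y => f y ^+ 2) (2 * f x * df).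
Proof.
move=> hf; apply: (@is_derive_eq _ _ _ _ _ _ _ _ (is_deriveX 2 hf)).
by rewrite expr1.
Qed.

Lemma derives_inv (f : R -> R) x df : f x != 0 ->
  is_derive x 1 f df -> is_derive x 1 (fun y => (f y)^-1) (- (f x) ^- 2 * df).
Proof. by move=> f0 hf; exact: is_deriveV. Qed.

Lemma derives_ln (f : R -> R) x df : 0 < f x ->
  is_derive x 1 f df -> is_derive x 1 (fun y => ln (f y)) ((f x)^-1 * df).
Proof.
by move=> f0 hf; apply: (is_derive1_comp (is_derive1_ln f0) hf).
Qed.

Ltac differentiate :=
  repeat first
    [ notypeclasses refine (derives_const _ _)
    | notypeclasses refine (derives_var _)
    | notypeclasses refine (derives_add _ _)
    | notypeclasses refine (derives_opp _)
    | notypeclasses refine (derives_sqr _)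
    | notypeclasses refine (derives_mul _ _)
    | notypeclasses refine (derives_inv _ _)
    | notypeclasses refine (derives_ln _ _) ].

Lemma le_of_derivative_ge0 (f df : R -> R) x y : 0 < x -> x <= y ->
  (forall z, 0 < z -> is_derive z 1 f (df z)) ->
  (forall c, x < c < y -> 0 <= df c) -> f x <= f y.
Proof.
move=> x0 xy fdf df0; have [->//|xney] := eqVneq x y.
have {xney}xy : x < y by rewrite lt_neqAle xney.
have [||c] := @MVT R f df x y xy.
- by move=> z; rewrite in_itv/= => /andP[xz _]; apply: fdf; exact: lt_trans xz.
- apply: derivable_within_continuous => z; rewrite in_itv/= => /andP[xz _].
  by have [] := fdf z (lt_le_trans x0 xz).
- rewrite in_itv/= => cxy E.
  by rewrite -subr_ge0 E mulr_ge0 ?df0// subr_ge0 ltW.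
Qed.

(** The sign is only required in the open interval: below, this keeps [c] away
from the point one, where [c - c^-1] vanishes. *)
Lemma ge_of_derivative_le0 (f df : R -> R) x y : 0 < x -> x <= y ->
  (forall z, 0 < z -> is_derive z 1 f (df z)) ->
  (forall c, x < c < y -> df c <= 0) -> f y <= f x.
Proof.
move=> x0 xy fdf df0; rewrite -lerN2.
apply: (@le_of_derivative_ge0 (- f) (fun z => - df z)) => // z.
  by move=> /fdf h; exact: is_deriveN.
by move=> h; rewrite oppr_ge0 df0.
Qed.

Lemma one_add_sqr_gt0 z : 0 < 1 + z ^+ 2.
Proof. by rewrite ltr_wpDr ?sqr_ge0. Qed.

(** In the variable [v = ln z] this is [tanh v <= v]; the difference has
derivative [(z ^+ 2 - 1) ^+ 2 / (z * (1 + z ^+ 2) ^+ 2)]. *)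
Lemma ln_ge_quotient z : 1 <= z -> (z ^+ 2 - 1) / (z ^+ 2 + 1) <= ln z.
Proof.
move=> z1.
pose f z : R := ln z + 2 * (1 + z ^+ 2)^-1.
pose df z : R := z^-1 - 4 * z * (1 + z ^+ 2) ^- 2.
have fdf (u : R) : 0 < u -> is_derive u 1 f (df u).
  move=> u0.
  have h : 1 + u ^+ 2 != 0 by apply: lt0r_neq0; nra.
  eapply is_derive_eq; first by differentiate.
  by rewrite /df /GRing.scale /=; field; rewrite ?h ?gt_eqF.
have : f 1 <= f z.
  apply: (le_of_derivative_ge0 ltr01 z1 fdf) => c /andP[c1 cz]; rewrite /df.
  have c0 : 0 < c by lra.
  have -> : c^-1 - 4 * c * (1 + c ^+ 2) ^- 2 =
     (c ^+ 2 - 1) ^+ 2 / (c * (1 + c ^+ 2) ^+ 2).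
    field. apply/andP; split; apply: lt0r_neq0; nra.
  by rewrite divr_ge0 ?sqr_ge0// mulr_ge0 ?sqr_ge0// ltW.
rewrite /f ln1.
have -> : (z ^+ 2 - 1) / (z ^+ 2 + 1) = 1 - 2 * (1 + z ^+ 2)^-1.
  field. apply: lt0r_neq0; nra.
have -> : 2 / (1 + 1 ^+ 2) = 1 :> R by field.
lra.
Qed.

(** In the variable [v = ln z] this is [v <= sinh v]. *)
Lemma ln_le_half_sub_inv z : 1 <= z -> 2 * ln z <= z - z^-1.
Proof.
move=> z1.
pose f z : R := z - z^-1 - 2 * ln z.
pose df z : R := 1 + z ^- 2 - 2 * z^-1.
have fdf (u : R) : 0 < u -> is_derive u 1 f (df u).
  move=> u0.
  have h : u != 0 by rewrite gt_eqF.
  eapply is_derive_eq; first by differentiate.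
  by rewrite /df /GRing.scale /=; field; rewrite ?h ?gt_eqF.
have : f 1 <= f z.
  apply: (le_of_derivative_ge0 ltr01 z1 fdf) => c /andP[c1 cz]; rewrite /df.
  have -> : 1 + c ^- 2 - 2 * c^-1 = (1 - c^-1) ^+ 2 by rewrite -exprVn; ring.
  exact: sqr_ge0.
rewrite /f ln1 invr1; lra.
Qed.

(** In the variable [v = ln z] this says that [sinh v / v] is nondecreasing, so
that [ln z / (z - z^-1)] is nonincreasing: for fixed [k] the difference of the
two sides has a derivative of the sign of
[ln k * (z + z^-1) - (k - k^-1)], which at [z = k] is [ln_ge_quotient] and
increases afterwards. *)
Lemma ln_sub_inv_le k z : 1 < k -> k <= z ->
  ln z * (k - k^-1) <= ln k * (z - z^-1).
Proof.
move=> k1 kz.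
pose f z : R := ln k * (z - z^-1) - ln z * (k - k^-1).
pose df z : R := ln k * (1 + z ^- 2) - z^-1 * (k - k^-1).
have fdf (u : R) : 0 < u -> is_derive u 1 f (df u).
  move=> u0.
  have h : u != 0 by rewrite gt_eqF.
  eapply is_derive_eq; first by differentiate.
  by rewrite /df /GRing.scale /=; field; rewrite h gt_eqF//; lra.
have k0 : 0 < k by lra.
have : f k <= f z.
  apply: (le_of_derivative_ge0 k0 kz fdf) => c /andP[c1 cz]; rewrite /df.
  have c0 : 0 < c by lra.
  have h : (k ^+ 2 - 1) / (k ^+ 2 + 1) <= ln k by apply: ln_ge_quotient; lra.
  have -> : ln k * (1 + c ^- 2) - c^-1 * (k - k^-1) =
     c^-1 * (ln k * (c + c^-1) - (k - k^-1)).
    by set d := k - k^-1; field; rewrite gt_eqF.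
  apply: mulr_ge0; first by rewrite invr_ge0 ltW.
  have h1 : k + k^-1 <= c + c^-1.
    rewrite -subr_ge0.
    have -> : c + c^-1 - (k + k^-1) = (c - k) * (c * k - 1) / (c * k).
      by field; rewrite !gt_eqF.
    rewrite divr_ge0//; [apply: mulr_ge0; nra|nra].
  have h2 : k - k^-1 = (k ^+ 2 - 1) / (k ^+ 2 + 1) * (k + k^-1).
    by field; rewrite !gt_eqF// addrC one_add_sqr_gt0.
  rewrite subr_ge0 h2.
  have h3 : 0 <= (k ^+ 2 - 1) / (k ^+ 2 + 1).
    rewrite divr_ge0//; nra.
  have h4 : 0 <= k^-1 by rewrite invr_ge0 ltW.
  apply: ler_pM => //; lra.
by rewrite /f !subrr; lra.
Qed.

(** The Shannon entropy of a two-point probability [(p, q)] whose odds are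
[p / q = z ^+ 2]. *)
Definition entropy_odds z : R :=
  ln (1 + z ^+ 2) - 2 * ln z + 2 * (1 + z ^+ 2)^-1 * ln z.

(** The geometric mean [sqrt (p * q)] for the same odds [p / q = z ^+ 2]. *)
Definition balance_odds z : R := z * (1 + z ^+ 2)^-1.

(** The derivative of [entropy_odds] with respect to [balance_odds] at [k], with
its limit at the uniform probability [k = 1], where both derivatives
vanish. *)
Definition tangent_slope k : R :=
  if k == 1 then 2 else 4 * ln k / (k - k^-1).

Lemma entropy_oddsV z : 0 < z -> entropy_odds z^-1 = entropy_odds z.
Proof.
move=> z0; have h := one_add_sqr_gt0 z.
have e : 1 + z^-1 ^+ 2 = (1 + z ^+ 2) / z ^+ 2 by field; rewrite gt_eqF.
rewrite /entropy_odds e lnV// ln_div ?posrE ?exprn_gt0// lnXn//.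
rewrite -mulr_natr; field.
by rewrite !gt_eqF// exprn_gt0.
Qed.

Lemma balance_oddsV z : 0 < z -> balance_odds z^-1 = balance_odds z.
Proof.
move=> z0; have h := one_add_sqr_gt0 z; have h' := one_add_sqr_gt0 z^-1.
rewrite /balance_odds; field.
by rewrite addrC !gt_eqF//= addrC.
Qed.

Lemma tangent_slopeV k : 0 < k -> tangent_slope k^-1 = tangent_slope k.
Proof.
move=> k0; rewrite /tangent_slope invr_eq1; case: eqP => // _.
by rewrite lnV// invrK -[k^-1 - k]opprB invrN; ring.
Qed.

(** The derivative of [entropy_odds z - tangent_slope k * balance_odds z] is a
positive multiple of the expression below; it changes sign at [k] because the
slope is nonincreasing. *)
Lemma slope_ge0 k c : 1 <= k -> k <= c ->
  0 <= tangent_slope k * (c - c^-1) - 4 * ln c.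
Proof.
move=> k1 kc; rewrite /tangent_slope.
case: eqP => [_|/eqP kn1].
  have := ln_le_half_sub_inv (le_trans k1 kc) => h; lra.
have {k1 kn1}k1 : 1 < k by rewrite lt_neqAle eq_sym kn1.
have e : 0 < k - k^-1 by rewrite subr_gt0 (lt_trans _ k1)// invf_lt1//; lra.
have := ln_sub_inv_le k1 kc => h.
by rewrite mulrAC subr_ge0 ler_pdivlMr//; lra.
Qed.

Lemma slope_le0 k c : 1 < c -> c <= k ->
  tangent_slope k * (c - c^-1) - 4 * ln c <= 0.
Proof.
move=> c1 ck; have k1 := lt_le_trans c1 ck.
rewrite /tangent_slope gt_eqF//.
have e : 0 < k - k^-1 by rewrite subr_gt0 (lt_trans _ k1)// invf_lt1//; lra.
have := ln_sub_inv_le c1 ck => h.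
by rewrite mulrAC subr_le0 ler_pdivrMr//; lra.
Qed.

Lemma entropy_odds_tangent_ge1 k z : 1 <= k -> 1 <= z ->
  tangent_slope k * (balance_odds z - balance_odds k) <=
  entropy_odds z - entropy_odds k.
Proof.
move=> k1 z1; set s := tangent_slope k.
pose f z : R := entropy_odds z - s * balance_odds z.
pose df z : R := z * (1 + z ^+ 2) ^- 2 * (s * (z - z^-1) - 4 * ln z).
have fdf (u : R) : 0 < u -> is_derive u 1 f (df u).
  move=> u0.
  have h0 := one_add_sqr_gt0 u.
  have h : 1 + u ^+ 2 != 0 by rewrite gt_eqF.
  rewrite /f /entropy_odds /balance_odds.
  eapply is_derive_eq; first by differentiate.
  by rewrite /df /GRing.scale /=; field; rewrite h gt_eqF.
suff : f k <= f z by rewrite /f; lra.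
have pos c : 0 < c -> 0 <= c * (1 + c ^+ 2) ^- 2.
  move=> c0; rewrite mulr_ge0 ?(ltW c0)// invr_ge0.
  by rewrite exprn_ge0// ltW// one_add_sqr_gt0.
have [kz|/ltW zk] := lerP k z.
  apply: (le_of_derivative_ge0 _ kz fdf) => [|c /andP[kc cz]]; first lra.
  rewrite mulr_ge0 ?pos//; first lra.
  by apply: slope_ge0 => //; exact: ltW.
apply: (ge_of_derivative_le0 _ zk fdf) => [|c /andP[zc ck]]; first lra.
rewrite mulr_ge0_le0 ?pos//; first lra.
by apply: slope_le0; lra.
Qed.

(** The entropy lies above its tangents as a function of the geometric mean.
Exchanging the two points inverts the odds and changes neither quantity, which
reduces everything to odds at least one. *)
Lemma entropy_odds_tangent k z : 0 < k -> 0 < z ->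
  tangent_slope k * (balance_odds z - balance_odds k) <=
  entropy_odds z - entropy_odds k.
Proof.
move=> k0 z0.
wlog k1 : k k0 / 1 <= k => [h|].
  have [|k1] := lerP 1 k; first exact: h.
  rewrite -(entropy_oddsV k0) -(balance_oddsV k0) -(tangent_slopeV k0).
  by apply: h; rewrite ?invr_gt0// invf_ge1// ltW.
wlog z1 : z z0 / 1 <= z => [h|].
  have [|z1] := lerP 1 z; first exact: h.
  rewrite -(entropy_oddsV z0) -(balance_oddsV z0).
  by apply: h; rewrite ?invr_gt0// invf_ge1// ltW.
exact: entropy_odds_tangent_ge1.
Qed.

Lemma ln_ge_sub_inv x : 0 < x -> 1 - x^-1 <= ln x.
Proof.
move=> x0; have := @le_ln1Dx R (x^-1 - 1).
rewrite addrCA subrr addr0 lnV ?posrE// => h.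
have : 0 < x^-1 by rewrite invr_gt0.
by move=> ?; have := h ltac:(lra); lra.
Qed.

(** Difference quotient of the increasing function [ln] between [1 - a] and
[a]. *)
Lemma log_quotient_gt0 a : 0 < a -> a < 1 -> 0 < log_quotient a.
Proof.
move=> a0 a1; have b0 : 0 < 1 - a by rewrite subr_gt0.
rewrite /log_quotient; case: eqP => // /eqP an.
have [h|h|/eqP] := ltgtP a (2^-1); last by rewrite (negbTE an).
  rewrite -mulrNN -invrN mulr_gt0 ?invr_gt0//; last by lra.
  by rewrite oppr_gt0 subr_lt0 ltr_ln ?posrE//; lra.
rewrite mulr_gt0 ?invr_gt0//; last by lra.
by rewrite subr_gt0 ltr_ln ?posrE//; lra.
Qed.

Lemma log_quotient_flip a : log_quotient (1 - a) = log_quotient a.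
Proof.
rewrite /log_quotient.
have -> : (1 - a == 2^-1) = (a == 2^-1) by apply/eqP/eqP; lra.
case: eqP => // /eqP an.
have h : 2 * a - 1 != 0 by apply: contra an => /eqP h; apply/eqP; lra.
have -> : 1 - (1 - a) = a by ring.
have -> : 2 * (1 - a) - 1 = - (2 * a - 1) by ring.
by rewrite invrN; ring.
Qed.

Lemma tangent_slope_log_quotient (A B : R) : 0 < A -> 0 < B ->
  A ^+ 2 + B ^+ 2 = 1 ->
  tangent_slope (A / B) = 2 * (A * B) * log_quotient (A ^+ 2).
Proof.
move=> A0 B0 AB1.
have eB : 1 - A ^+ 2 = B ^+ 2 by rewrite -AB1; ring.
rewrite /tangent_slope /log_quotient eB; have [AB|AB] := eqVneq A B.
  have hA : A ^+ 2 = 2^-1 by move: AB1; rewrite -AB; lra.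
  by rewrite -AB hA (divff (lt0r_neq0 A0)) !eqxx -expr2 hA; field.
have -> : (A / B == 1) = false.
  apply: contraNF AB => /eqP h.
  by rewrite -[X in X == _](divfK (lt0r_neq0 B0)) h mul1r.
have -> : (A ^+ 2 == 2^-1) = false.
  apply: contraNF AB => /eqP h.
  rewrite -(@eqrXn2 _ 2)// ?ltW//; apply/eqP; lra.
have -> : 2 * A ^+ 2 - 1 = A ^+ 2 - B ^+ 2 by rewrite -eB; ring.
rewrite !lnXn// -[ln A *+ 2]mulr_natr -[ln B *+ 2]mulr_natr ln_div ?posrE//.
have h : A ^+ 2 - B ^+ 2 != 0.
  by rewrite subr_eq0 eqrXn2// ltW.
by field; rewrite h !gt_eqF.
Qed.

(** The shares of the two points in the mean square [S] are [a * x ^+ 2 / S] and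
[(1 - a) * y ^+ 2 / S], with odds [(A / B * (x / y)) ^+ 2] for
[A = sqrt a], [B = sqrt (1 - a)]; equal values [x = y] give the odds
[(A / B) ^+ 2], the point of tangency. The inequality is [S] times
[entropy_odds_tangent] at these odds. *)
Lemma two_point_log_sobolev_pos a x y : 0 < a -> a < 1 -> 0 < x -> 0 < y ->
  a * (x ^+ 2 * ln (x ^+ 2)) + (1 - a) * (y ^+ 2 * ln (y ^+ 2)) -
  (a * x ^+ 2 + (1 - a) * y ^+ 2) * ln (a * x ^+ 2 + (1 - a) * y ^+ 2) <=
  a * (1 - a) * log_quotient a * (x - y) ^+ 2.
Proof.
move=> a0 a1 x0 y0; have b0 : 0 < 1 - a by rewrite subr_gt0.
have key : (a * (1 - a)) * (y ^+ 2 - x ^+ 2) * (ln a - ln (1 - a)) =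
    a * (1 - a) * log_quotient a * ((2 * a - 1) * (y ^+ 2 - x ^+ 2)).
  rewrite /log_quotient; case: eqP => [ah|/eqP ah].
    have -> : 1 - a = a by lra.
    have -> : 2 * a - 1 = 0 by lra.
    by rewrite subrr; ring.
  have h : 2 * a - 1 != 0 by apply: contra ah => /eqP h; apply/eqP; lra.
  by set d := ln a - _; field.
set Q := log_quotient a in key *.
have [A [B [A0 B0 eA eB]]] : exists A B : R,
    [/\ 0 < A, 0 < B, A ^+ 2 = a & B ^+ 2 = 1 - a].
  exists (Num.sqrt a), (Num.sqrt (1 - a)).
  by rewrite !sqrtr_gt0 !sqr_sqrtr// ltW.
have slopeE : tangent_slope (A / B) = 2 * (A * B) * Q.
  by rewrite tangent_slope_log_quotient ?eA// eB; ring.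
have AB0 : 0 < A / B by rewrite divr_gt0.
have z0 : 0 < A / B * (x / y) by rewrite mulr_gt0// divr_gt0.
have := entropy_odds_tangent AB0 z0; rewrite slopeE.
set S := a * x ^+ 2 + (1 - a) * y ^+ 2.
have S0 : 0 < S by rewrite addr_gt0// mulr_gt0// exprn_gt0.
have e1 : 1 + (A / B) ^+ 2 = (1 - a)^-1.
  by rewrite expr_div_n eA eB; field; rewrite gt_eqF.
have e2 : 1 + (A / B * (x / y)) ^+ 2 = S / ((1 - a) * y ^+ 2).
  by rewrite exprMn !expr_div_n eA eB /S; field; rewrite !gt_eqF.
have AB2 : ln (A / B) * 2 = ln a - ln (1 - a).
  by rewrite mulr_natr -lnXn// expr_div_n eA eB ln_div.
have xy2 : ln (x / y) * 2 = ln (x ^+ 2) - ln (y ^+ 2).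
  by rewrite mulr_natr -lnXn ?divr_gt0// expr_div_n ln_div// posrE exprn_gt0.
have b1 : balance_odds (A / B) = A * B.
  by rewrite /balance_odds e1 invrK -eB; field; rewrite gt_eqF.
have b2 : balance_odds (A / B * (x / y)) = A * B * x * y / S.
  by rewrite /balance_odds e2 -eB; field; rewrite !gt_eqF.
have h1 : entropy_odds (A / B) = - (a * ln a) - (1 - a) * ln (1 - a).
  rewrite /entropy_odds e1 invrK lnV ?posrE//.
  have -> : 2 * ln (A / B) = ln a - ln (1 - a) by rewrite -AB2 mulrC.
  have -> : 2 * (1 - a) * ln (A / B) = (1 - a) * (ln a - ln (1 - a)).
    by rewrite -AB2; ring.
  by ring.
have h2 : entropy_odds (A / B * (x / y)) = ln S -
    a * x ^+ 2 / S * (ln a + ln (x ^+ 2)) -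
    (1 - a) * y ^+ 2 / S * (ln (1 - a) + ln (y ^+ 2)).
  rewrite /entropy_odds e2 ln_div ?posrE ?mulr_gt0 ?exprn_gt0//.
  rewrite [ln ((1 - a) * _)]lnM ?posrE ?exprn_gt0//.
  rewrite [ln (A / B * _)]lnM ?posrE ?divr_gt0//.
  have -> : 2 * (ln (A / B) + ln (x / y)) =
     ln a - ln (1 - a) + (ln (x ^+ 2) - ln (y ^+ 2)).
    by rewrite -AB2 -xy2; ring.
  have -> : 2 * (S / ((1 - a) * y ^+ 2))^-1 * (ln (A / B) + ln (x / y)) =
     (1 - a) * y ^+ 2 / S *
     (ln a - ln (1 - a) + (ln (x ^+ 2) - ln (y ^+ 2))).
    by rewrite -AB2 -xy2; field; rewrite !gt_eqF.
  have -> : a * x ^+ 2 / S = 1 - (1 - a) * y ^+ 2 / S.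
    by rewrite /S; field; rewrite gt_eqF.
  by ring.
rewrite b1 b2 h1 h2 -subr_ge0 => /(mulr_ge0 (ltW S0)) H.
rewrite -subr_ge0; apply: (le_trans H); rewrite le_eqVlt; apply/orP; left; apply/eqP.
set lS := ln S; set lx := ln (x ^+ 2); set ly := ln (y ^+ 2).
set la := ln a in key *; set lb := ln (1 - a) in key *.
transitivity (S * lS - a * x ^+ 2 * (la + lx) - (1 - a) * y ^+ 2 * (lb + ly)
  + S * (a * la + (1 - a) * lb) - 2 * Q * A ^+ 2 * B ^+ 2 * (x * y - S)).
  by field; rewrite gt_eqF.
rewrite eA eB.
transitivity (a * (1 - a) * (y ^+ 2 - x ^+ 2) * (la - lb) + S * lS
   - a * x ^+ 2 * lx - (1 - a) * y ^+ 2 * ly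
   - 2 * Q * a * (1 - a) * (x * y - S)).
  by rewrite /S; ring.
by rewrite key /S; ring.
Qed.

(** The case where one value vanishes, as the limit [x -> 0] of the positive case
with [y = 1]. *)
Lemma two_point_log_sobolev_0 a : 0 < a -> a < 1 ->
  - ln (1 - a) <= a * log_quotient a.
Proof.
move=> a0 a1; have b0 : 0 < 1 - a by rewrite subr_gt0.
rewrite -(ler_pM2l b0); apply/ler_addgt0Pr => e e0.
(* the error terms below add up to at most [3 * a * x] *)
pose x := Num.min (2^-1) (e / (3 * a)).
have x0 : 0 < x by rewrite lt_min; apply/andP; split; [lra|rewrite divr_gt0//; lra].
have x1 : x <= 2^-1 by rewrite ge_min lexx.
have xe : 3 * a * x <= e.
  by rewrite mulrC -ler_pdivlMr ?mulr_gt0// ge_min lexx orbT.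
have := two_point_log_sobolev_pos a0 a1 x0 ltr01.
rewrite expr1n ln1 !mulr0 !mulr1 addr0.
set S := a * x ^+ 2 + (1 - a).
have S1 : S <= 1.
  have x2 : x ^+ 2 <= 1 by nra.
  have : 0 <= a * (1 - x ^+ 2) by rewrite mulr_ge0 ?subr_ge0// ltW.
  by rewrite /S; lra.
have S0 : 1 - a <= S by rewrite /S lerDr mulr_ge0 ?sqr_ge0// ltW.
have hx : - x <= x ^+ 2 * ln (x ^+ 2) / 2.
  rewrite lnXn// -[ln x *+ 2]mulr_natr mulrA mulfK//.
  have := ln_ge_sub_inv x0 => h.
  have : x ^+ 2 * (1 - x^-1) <= x ^+ 2 * ln x by rewrite ler_wpM2l ?sqr_ge0.
  have -> : x ^+ 2 * (1 - x^-1) = x ^+ 2 - x by field; rewrite gt_eqF.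
  by have := sqr_ge0 x; lra.
have hS : S * ln S <= (1 - a) * ln (1 - a) + a * x ^+ 2.
  have lS0 : ln S <= 0 by apply: ln_le0.
  have : S * ln S <= (1 - a) * ln S by rewrite ler_wnM2r.
  have : ln S <= ln (1 - a) + a * x ^+ 2 / (1 - a).
    have -> : S = (1 - a) * (1 + a * x ^+ 2 / (1 - a)).
      by rewrite /S; field; rewrite gt_eqF.
    have p0 : 0 <= a * x ^+ 2 / (1 - a).
      by rewrite divr_ge0 ?mulr_ge0 ?sqr_ge0// ltW.
    rewrite lnM ?posrE//; last by lra.
    by rewrite lerD2l; apply: le_ln1Dx; lra.
  rewrite -(ler_pM2l b0).
  have -> : (1 - a) * (ln (1 - a) + a * x ^+ 2 / (1 - a)) =
     (1 - a) * ln (1 - a) + a * x ^+ 2 by field; rewrite gt_eqF.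
  lra.
have Q0 := log_quotient_gt0 a0 a1.
have : a * (1 - a) * log_quotient a * (x - 1) ^+ 2 <=
       a * (1 - a) * log_quotient a * 1.
  by rewrite ler_wpM2l ?mulr_ge0 ?ltW//; nra.
have : 0 <= a * (x - x ^+ 2) by rewrite mulr_ge0 ?ltW//; nra.
have : a * - x <= a * (x ^+ 2 * ln (x ^+ 2) / 2) by rewrite ler_wpM2l// ltW.
lra.
Qed.

Lemma two_point_log_sobolev a x y : 0 < a -> a < 1 -> 0 <= x -> 0 <= y ->
  a * (x ^+ 2 * ln (x ^+ 2)) + (1 - a) * (y ^+ 2 * ln (y ^+ 2)) -
  (a * x ^+ 2 + (1 - a) * y ^+ 2) * ln (a * x ^+ 2 + (1 - a) * y ^+ 2) <=
  a * (1 - a) * log_quotient a * (x - y) ^+ 2.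
Proof.
move=> a0 a1; rewrite le0r => /predU1P[->|x0]; last first.
  rewrite le0r => /predU1P[->|y0]; last exact: two_point_log_sobolev_pos.
  have := @two_point_log_sobolev_0 (1 - a); rewrite log_quotient_flip.
  rewrite subKr => h; have {}h : - ln a <= (1 - a) * log_quotient a by apply: h; lra.
  have ax0 : 0 <= a * x ^+ 2 by rewrite mulr_ge0 ?sqr_ge0// ltW.
  have := ler_wpM2l ax0 h.
  rewrite expr0n/= mul0r !mulr0 !addr0 subr0 [ln (a * _)]lnM ?posrE ?exprn_gt0//; lra.
rewrite le0r => /predU1P[->|y0].
  by rewrite expr0n/= mul0r !mulr0 addr0 mul0r !subr0 expr0n mulr0.
have by0 : 0 <= (1 - a) * y ^+ 2 by rewrite mulr_ge0 ?sqr_ge0//; lra.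
have := ler_wpM2l by0 (two_point_log_sobolev_0 a0 a1).
rewrite expr0n/= mul0r !mulr0 !add0r [ln ((1 - a) * _)]lnM ?posrE ?exprn_gt0 ?subr_gt0//; lra.
Qed.

End two_point_inequality.

(** * Variance and entropy of bounded functions *)

Section variance_and_entropy.
Context {d} {T : measurableType d} {R : realType}.
Implicit Types (mu nu : {measure set T -> \bar R}) (D : set T) (f g : T -> R).

(** The class of functions for which all integrals below are finite: it is stable
under the operations used, including [g |-> g * ln g] for nonnegative [g]. *)
Definition bounded_measurable D f :=
  measurable_fun D f /\ exists B : R, forall x, D x -> `|f x| <= B.

Lemma bounded_measurable_cst D (c : R) : bounded_measurable D (fun=> c).
Proof. by split; [exact: measurable_cst|exists `|c|]. Qed.

Lemma bounded_measurableD D f g : bounded_measurable D f ->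
  bounded_measurable D g -> bounded_measurable D (fun x => f x + g x).
Proof.
move=> [mf [B fB]] [mg [C gC]]; split; first exact: measurable_funD.
exists (B + C) => x Dx; apply: (le_trans (ler_normD _ _)).
by apply: lerD; [exact: fB|exact: gC].
Qed.

Lemma bounded_measurableM D f g : bounded_measurable D f ->
  bounded_measurable D g -> bounded_measurable D (fun x => f x * g x).
Proof.
move=> [mf [B fB]] [mg [C gC]]; split; first exact: measurable_funM.
exists (B * C) => x Dx; rewrite normrM.
by apply: ler_pM => //; [exact: fB|exact: gC].
Qed.

Lemma bounded_measurableZ D f (c : R) : bounded_measurable D f ->
  bounded_measurable D (fun x => c * f x).
Proof.
by move=> bf; apply: bounded_measurableM => //; exact: bounded_measurable_cst.
Qed.

Lemma bounded_measurableX D f : bounded_measurable D f ->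
  bounded_measurable D (fun x => f x ^+ 2).
Proof. by move=> bf; exact: bounded_measurableM. Qed.

(** The convex function [x * ln x] lies below a quadratic polynomial that
touches it at [m]. *)
Lemma mulr_ln_le (x m : R) : 0 <= x -> 0 < m ->
  x * ln x <= x * ln m + x * (x / m - 1).
Proof.
rewrite le0r => /predU1P[->|x0 m0]; first by rewrite !mul0r addr0.
rewrite -mulrDr ler_pM2l// -lerBlDl -ln_div ?posrE//.
have xm : 0 < x / m by rewrite divr_gt0.
have := @le_ln1Dx R (x / m - 1); rewrite addrCA subrr addr0; apply; lra.
Qed.

Lemma mulr_ln_ge (x : R) : 0 <= x -> x - 1 <= x * ln x.
Proof.
rewrite le0r => /predU1P[->|x0]; first by rewrite mul0r; lra.
have := ln_ge_sub_inv x0; rewrite -(ler_pM2l x0).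
by rewrite mulrBr mulr1 divff ?gt_eqF.
Qed.

Lemma bounded_measurable_mulr_ln D g : (forall x, D x -> 0 <= g x) ->
  bounded_measurable D g -> bounded_measurable D (fun x => g x * ln (g x)).
Proof.
move=> g0 [mg [B gB]]; split.
  by apply: measurable_funM => //; exact: measurableT_comp.
exists (B ^+ 2 + 1) => x Dx; have gx0 := g0 _ Dx.
have := gB _ Dx; rewrite ger0_norm// => gxB.
have := mulr_ln_ge gx0; have := mulr_ln_le gx0 ltr01.
by rewrite ln1 divr1 mulr0 add0r => h1 h2; rewrite ler_norml; nra.
Qed.

Section unit_mass.
Variables (mu : {measure set T -> \bar R}) (D : set T).
Hypotheses (mD : measurable D) (muD : mu D = 1%E).

Lemma bounded_measurable_integrable f : bounded_measurable D f ->
  mu.-integrable D (EFin \o f).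
Proof.
move=> [mf [B fB]]; apply: measurable_bounded_integrable => //.
  by rewrite muD ltry.
by exists B; split; [exact: num_real|move=> C BC x Dx; exact: le_trans (fB x Dx) (ltW BC)].
Qed.
Let intble := bounded_measurable_integrable.

Lemma integral_unit_cst (c : R) : \int[mu]_(x in D) c = c.
Proof. by rewrite Rintegral_cst// muD mulr1. Qed.

Lemma integral_lin f g (b c : R) : bounded_measurable D f ->
  bounded_measurable D g ->
  \int[mu]_(x in D) (f x + b * g x + c) =
  \int[mu]_(x in D) f x + b * \int[mu]_(x in D) g x + c.
Proof.
move=> bf bg; have bbg := bounded_measurableZ b bg.
rewrite RintegralD//; last 2 first.
- exact/intble/bounded_measurableD.
- exact/intble/bounded_measurable_cst.
rewrite integral_unit_cst RintegralD//; [|exact: intble..].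
by rewrite RintegralZl//; exact: intble.
Qed.

Lemma integral_sqr_sub f (c : R) : bounded_measurable D f ->
  \int[mu]_(x in D) (f x - c) ^+ 2 =
  Var mu D f + (\int[mu]_(x in D) f x - c) ^+ 2.
Proof.
move=> bf; rewrite /Var.
transitivity (\int[mu]_(x in D) (f x ^+ 2 + (- (2 * c)) * f x + c ^+ 2)).
  by apply: eq_Rintegral => x _; ring.
by rewrite (integral_lin (- (2 * c)) (c ^+ 2) (bounded_measurableX bf) bf); ring.
Qed.

Lemma Var_ge0 f : bounded_measurable D f -> 0 <= Var mu D f.
Proof.
move=> bf; have := integral_sqr_sub (\int[mu]_(x in D) f x) bf.
rewrite subrr expr0n addr0 => <-.
by apply: Rintegral_ge0 => x _; exact: sqr_ge0.
Qed.

Lemma Var_shift f (k : R) : bounded_measurable D f ->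
  Var mu D (fun x => f x + k) = Var mu D f.
Proof.
move=> bf; have := integral_sqr_sub (- k) bf; rewrite /Var.
have e : \int[mu]_(x in D) (f x + k) = \int[mu]_(x in D) f x + k.
  rewrite RintegralD ?integral_unit_cst//; apply: intble => //.
  exact: bounded_measurable_cst.
by rewrite !opprK e => ->; ring.
Qed.

(** With [m] the mean of [f ^+ 2] and [s = sqrt m], the bound
[ln u >= 1 - u^-1] at [u = f / s] gives the pointwise inequality
[f^2 ln f^2 - f^2 ln m - f^2 + m >= (f - s)^2], whose integral is the claim,
because the variance minimises the mean square distance to a constant.
The hypothesis [1 <= f] keeps [f] and [m] away from zero. *)
Lemma Var_le_Ent f : bounded_measurable D f -> (forall x, D x -> 1 <= f x) ->
  Var mu D f <= Ent mu D (fun x => f x ^+ 2).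
Proof.
move=> bf f1; set m := \int[mu]_(x in D) (f x ^+ 2).
have bf2 := bounded_measurableX bf.
have bL : bounded_measurable D (fun x => f x ^+ 2 * ln (f x ^+ 2)).
  by apply: bounded_measurable_mulr_ln => // x _; exact: sqr_ge0.
have m1 : 1 <= m.
  rewrite -[leLHS](integral_unit_cst 1) le_Rintegral//.
  - exact/intble/bounded_measurable_cst.
  - exact: intble.
  - by move=> x /f1 fx; rewrite expr_ge1//; lra.
have m0 : 0 < m by lra.
pose s := Num.sqrt m.
have s0 : 0 < s by rewrite sqrtr_gt0.
have sm : s ^+ 2 = m by rewrite sqr_sqrtr// ltW.
have -> : Ent mu D (fun x => f x ^+ 2) =
  \int[mu]_(x in D) (f x ^+ 2 * ln (f x ^+ 2) + (- (ln m + 1)) * f x ^+ 2 + m).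
  by rewrite (integral_lin (- (ln m + 1)) m bL bf2) /Ent -/m; ring.
apply: (@le_trans _ _ (\int[mu]_(x in D) (f x - s) ^+ 2)).
  by rewrite integral_sqr_sub// lerDl sqr_ge0.
apply: le_Rintegral => //.
- apply/intble/bounded_measurableX/bounded_measurableD => //.
  exact: bounded_measurable_cst.
- apply: intble; apply: bounded_measurableD; last exact: bounded_measurable_cst.
  by apply: bounded_measurableD => //; exact: bounded_measurableZ.
move=> x /f1 fx; have fx0 : 0 < f x by lra.
have := ln_ge_sub_inv (divr_gt0 fx0 s0).
rewrite ln_div ?posrE// invf_div => h.
have : f x ^+ 2 * (1 - s / f x) <= f x ^+ 2 * (ln (f x) - ln s).
  by rewrite ler_wpM2l// sqr_ge0.
have -> : f x ^+ 2 * (1 - s / f x) = f x ^+ 2 - f x * s.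
  by field; rewrite gt_eqF.
rewrite -sm !lnXn// -[ln (f x) *+ 2]mulr_natr -[ln s *+ 2]mulr_natr; lra.
Qed.

(** A function of zero variance is almost everywhere equal to its mean [c]. To
stay with integrals, [f^2 ln f^2] is bounded by [mulr_ln_le] at the mean of
[f ^+ 2], which is [c ^+ 2], and the remainder is dominated by a multiple of
[(f - c) ^+ 2], of zero integral. *)
Lemma Ent_sqr_le0 f : bounded_measurable D f -> Var mu D f <= 0 ->
  Ent mu D (fun x => f x ^+ 2) <= 0.
Proof.
move=> bf V0; set c := \int[mu]_(x in D) f x.
have {V0}V0 : Var mu D f = 0 by apply/eqP; rewrite eq_le V0 Var_ge0.
(* zero variance means that the mean square is the square of the mean *)
have mc : \int[mu]_(x in D) (f x ^+ 2) = c ^+ 2.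
  by move: V0; rewrite /Var => /eqP; rewrite subr_eq0 => /eqP.
have dev : \int[mu]_(x in D) (f x - c) ^+ 2 = 0.
  by rewrite integral_sqr_sub// V0 subrr expr0n addr0.
have bf2 := bounded_measurableX bf.
have bL : bounded_measurable D (fun x => f x ^+ 2 * ln (f x ^+ 2)).
  by apply: bounded_measurable_mulr_ln => // x _; exact: sqr_ge0.
have bdev : bounded_measurable D (fun x => (f x - c) ^+ 2).
  apply/bounded_measurableX/bounded_measurableD => //.
  exact: bounded_measurable_cst.
have [B fB] := bf.2.
rewrite /Ent mc subr_le0; have [c0|c0] := eqVneq c 0.
  rewrite c0 expr0n mul0r.
  have -> : 0 = B ^+ 2 * \int[mu]_(x in D) (f x ^+ 2) by rewrite mc c0 expr0n mulr0.
  rewrite -RintegralZl//; last exact: intble.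
  apply: le_Rintegral => //; [exact: intble|exact/intble/bounded_measurableZ|].
  move=> x Dx; have := fB _ Dx => h.
  have := mulr_ln_le (sqr_ge0 (f x)) ltr01; rewrite ln1 mulr0 add0r divr1.
  have : f x ^+ 2 <= B ^+ 2 by rewrite -real_normK ?num_real// lerXn2r ?nnegrE//; apply: le_trans h.
  by have := sqr_ge0 (f x) => ? ? ?; nra.
have m0 : 0 < c ^+ 2 by rewrite exprn_even_gt0.
set m := c ^+ 2 in m0 mc *.
(* [(f^2 - c^2)^2 = (f - c)^2 (f + c)^2], with [f + c] bounded *)
pose K := (B + `|c|) ^+ 2 / m.
have -> : m * ln m = \int[mu]_(x in D)
   (K * (f x - c) ^+ 2 + (ln m + 1) * f x ^+ 2 + (- m)).
  have := integral_lin (ln m + 1) (- m) (bounded_measurableZ K bdev) bf2.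
  move=> ->; rewrite RintegralZl//; last exact: intble.
  by rewrite dev mc; ring.
apply: le_Rintegral => //; first exact: intble.
  apply: intble; apply: bounded_measurableD; last exact: bounded_measurable_cst.
  by apply: bounded_measurableD => //; exact: bounded_measurableZ.
move=> x Dx; apply: (le_trans (mulr_ln_le (sqr_ge0 (f x)) m0)).
have h : (f x + c) ^+ 2 <= (B + `|c|) ^+ 2.
  have : `|f x + c| <= B + `|c|.
    by apply: (le_trans (ler_normD _ _)); rewrite lerD2r fB.
  by move=> h; rewrite -real_normK ?num_real// lerXn2r ?nnegrE//; exact: le_trans h.
have := ler_wpM2r (sqr_ge0 (f x - c)) h.
move=> h'; rewrite -subr_ge0.
have -> : K * (f x - c) ^+ 2 + (ln m + 1) * f x ^+ 2 - m -
    (f x ^+ 2 * ln m + f x ^+ 2 * (f x ^+ 2 / m - 1)) =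
  ((B + `|c|) ^+ 2 * (f x - c) ^+ 2 - (f x + c) ^+ 2 * (f x - c) ^+ 2) / m.
  by rewrite /K /m; field.
by rewrite divr_ge0 ?subr_ge0// ltW.
Qed.

End unit_mass.

(** The triangle inequality for the vectors (mean, standard deviation), which
reduces to [p * q <= sqrt A * sqrt B] since a mean is at most the root of the
mean square. *)
Lemma sqrt_moment_gap mu nu D D' f : measurable D -> measurable D' ->
  mu D = 1%E -> nu D' = 1%E ->
  bounded_measurable D f -> bounded_measurable D' f ->
  (Num.sqrt (\int[mu]_(x in D) (f x ^+ 2)) -
   Num.sqrt (\int[nu]_(x in D') (f x ^+ 2))) ^+ 2 <=
  Var mu D f + Var nu D' f +
  (\int[mu]_(x in D) f x - \int[nu]_(x in D') f x) ^+ 2.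
Proof.
move=> mD mD' muD nuD' bf bf'.
have := Var_ge0 mD muD bf; have := Var_ge0 mD' nuD' bf'; rewrite /Var.
set A := \int[mu]_(x in D) (f x ^+ 2); set B := \int[nu]_(x in D') (f x ^+ 2).
set p := \int[mu]_(x in D) f x; set q := \int[nu]_(x in D') f x.
move=> hB hA.
have A0 : 0 <= A by have := sqr_ge0 p; lra.
have B0 : 0 <= B by have := sqr_ge0 q; lra.
have : p * q <= Num.sqrt A * Num.sqrt B.
  apply: (le_trans (ler_norm _)); rewrite normrM -!sqrtr_sqr.
  by apply: ler_pM; rewrite ?sqrtr_ge0// ler_sqrt//; lra.
have := sqr_sqrtr A0; have := sqr_sqrtr B0.
set a := Num.sqrt A; set b := Num.sqrt B => e1 e2 h.
by rewrite -e1 -e2; nra.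
Qed.

End variance_and_entropy.

(** * Optimal constants *)

Section optimal_constants.
Context {R : realType}.
Local Open Scope ereal_scope.

(** A strict upper bound on a nonnegative combination of two infima is witnessed
by elements of the two sets. The two hypotheses relating [SL] and [SC] exclude
infima of opposite infinite signs, for which the sum is [-oo] although one of
the sets is empty. When a coefficient is zero the corresponding set may be
empty, so membership is only claimed for positive coefficients. *)
Lemma optimal_constants_attained (SL SC : set R) (u v r : R) :
  (0 <= u)%R -> (0 <= v)%R -> SL `<=` SC ->
  (ereal_inf (EFin @` SC) = -oo -> ereal_inf (EFin @` SL) = -oo) ->
  u%:E * ereal_inf (EFin @` SL) + v%:E * ereal_inf (EFin @` SC) < r%:E ->
  exists l c : R, [/\ ((0 < u)%R -> SL l), ((0 < v)%R -> SC c) &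
    (u * l + v * c <= r)%R].
Proof.
move=> u0 v0 SLC Noo.
have approx (S : set R) (x : R) : ereal_inf (EFin @` S) < x%:E ->
    exists2 y, S y & (y < x)%R.
  by move=> /ereal_inf_lt[_ [y Sy <-]]; rewrite lte_fin; exists y.
have single (S : set R) (w : R) : (0 < w)%R ->
    w%:E * ereal_inf (EFin @` S) < r%:E -> exists2 y, S y & (w * y <= r)%R.
  move=> w0 h; have [|y Sy yr] := approx S (r / w)%R.
    by rewrite -(@lte_pmul2l _ w%:E)// -EFinM mulrCA divff ?gt_eqF// mulr1.
  by exists y => //; rewrite mulrC -ler_pdivlMr// ltW.
move: u0 v0; rewrite le0r => /predU1P[->|u0]; rewrite le0r => /predU1P[->|v0].
- rewrite !mul0e adde0 lte_fin => r0; exists 0%R, 0%R.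
  by rewrite ltxx mulr0 addr0 ltW.
- rewrite mul0e add0e => /(single _ _ v0)[c Sc cr]; exists 0%R, c.
  by rewrite ltxx mulr0 add0r.
- rewrite mul0e adde0 => /(single _ _ u0)[l Sl lr]; exists l, 0%R.
  by rewrite ltxx mulr0 addr0.
have LC : ereal_inf (EFin @` SC) <= ereal_inf (EFin @` SL).
  apply: le_ereal_inf_tmp => _ [x /SLC Sx <-].
  by apply: ereal_inf_lbound; exists x.
move: LC Noo (approx SL) (approx SC).
case: (ereal_inf (EFin @` SL)) => [l0||];
  case: (ereal_inf (EFin @` SC)) => [c0||] //=.
- move=> _ _ aL aC; rewrite -!EFinM -EFinD lte_fin => h.
  pose e := ((r - (u * l0 + v * c0)) / (u + v))%R.
  have uv : (0 < u + v)%R by lra.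
  have e0 : (0 < e)%R by rewrite divr_gt0//; lra.
  have eE : (e * (u + v) = r - (u * l0 + v * c0))%R by rewrite divfK// gt_eqF.
  have [|l Sl ll] := aL (l0 + e)%R; first by rewrite lte_fin; lra.
  have [|c Sc cl] := aC (c0 + e)%R; first by rewrite lte_fin; lra.
  exists l, c; split => //.
  have : (u * l <= u * (l0 + e))%R by rewrite ler_pM2l// ltW.
  have : (v * c <= v * (c0 + e))%R by rewrite ler_pM2l// ltW.
  lra.
- by move=> _ /(_ erefl).
- by rewrite gt0_muley ?lte_fin// -EFinM.
- by rewrite !gt0_muley ?lte_fin.
- by move=> _ /(_ erefl).
- move=> _ _ aL aC _.
  have [|c Sc _] := aL 0%R; first by rewrite ltNyr.
  have [|l Sl ll] := aL ((r - v * c) / u)%R; first by rewrite ltNyr.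
  exists l, c; split => //; first by move=> _; exact: SLC.
  move: ll; rewrite ltr_pdivlMr//; lra.
Qed.

End optimal_constants.

Section optimal_constants_of_a_class.
Context {d} {T : measurableType d} {R : realType}.
Variables (mu : {measure set T -> \bar R}) (D : set T).
Hypotheses (mD : measurable D) (muD : mu D = 1%E).
Variables (F : set (T -> R)) (E : (T -> R) -> R).
Hypothesis F_bounded : forall f, F f -> bounded_measurable D f.
Hypothesis F_shift : forall f (k : R), F f -> F (fun x => f x + k).
Hypothesis E_ge0 : forall f, 0 <= E f.
Hypothesis E_shift : forall f (k : R), E (fun x => f x + k) = E f.

Let entropy f := Ent mu D (fun x => f x ^+ 2).

(** Variance and energy do not see the addition of a constant, so [f] may be
assumed to be at least one. *)
Lemma poincare_of_log_sobolev (c : R) :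
  (forall f, F f -> entropy f <= c * E f) ->
  forall f, F f -> Var mu D f <= c * E f.
Proof.
move=> LS f Ff; have bf := F_bounded Ff; have [_ [B fB]] := bf.
(* [f >= - B], so that [f + (B + 1) >= 1] *)
rewrite -(Var_shift mD muD (B + 1) bf) -(E_shift f (B + 1)).
apply: le_trans (LS _ (F_shift (B + 1) Ff)).
apply: Var_le_Ent => //; first exact/F_bounded/F_shift.
by move=> x /fB; rewrite ler_norml => /andP[h _]; lra.
Qed.

(** If some negative constant is admissible in the Poincare inequality, then all
variances and energies vanish, and the entropies with them. *)
Lemma log_sobolev_degenerate :
  optimal_constant F (Var mu D) E = -oo%E ->
  optimal_constant F entropy E = -oo%E.
Proof.
rewrite /optimal_constant => C0.
have [_ [c Cc <-] c0] : exists2 y : \bar R,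
    (EFin @` [set c : R | forall f, F f -> Var mu D f <= c * E f]) y & (y < 0)%E.
  by apply: ereal_inf_lt; rewrite C0 ltNyr.
rewrite lte_fin in c0.
suff -> : [set c | forall f, F f -> entropy f <= c * E f] = setT.
  exact: ereal_inf_real.
apply/seteqP; split=> // r _ f Ff; have bf := F_bounded Ff.
have V0 := Var_ge0 mD muD bf; have Vc := Cc _ Ff; have E0 := E_ge0 f.
have ->: E f = 0.
  apply/eqP; rewrite eq_le E0 andbT.
  by rewrite -(ler_nM2l c0) mulr0 (le_trans V0).
rewrite mulr0; apply: Ent_sqr_le0 => //; apply: (le_trans Vc).
by rewrite mulr_le0_ge0// ltW.
Qed.

(** The form in which optimal constants are used: nothing is assumed on their
finiteness or sign. *)
Lemma optimal_constants_combination (u v r : R) : 0 <= u -> 0 <= v ->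
  (u%:E * optimal_constant F entropy E +
   v%:E * optimal_constant F (Var mu D) E < r%:E)%E ->
  forall f, F f -> u * entropy f + v * Var mu D f <= r * E f.
Proof.
move=> u0 v0 h f Ff.
have [||l [c [Sl Sc lcr]]] := optimal_constants_attained u0 v0 _ _ h.
- exact: poincare_of_log_sobolev.
- exact: log_sobolev_degenerate.
have hu : u * entropy f <= u * l * E f.
  move: u0; rewrite le0r => /predU1P[->|u0]; first by rewrite !mul0r.
  by rewrite -mulrA ler_pM2l//; exact: Sl.
have hv : v * Var mu D f <= v * c * E f.
  move: v0; rewrite le0r => /predU1P[->|v0]; first by rewrite !mul0r.
  by rewrite -mulrA ler_pM2l//; exact: Sc.
apply: (le_trans (lerD hu hv)); rewrite -mulrDl.
exact: ler_wpM2r.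
Qed.

End optimal_constants_of_a_class.

(** * Mixtures of two probability measures *)

Section mixtures.
Context {d} {T : measurableType d} {R : realType}.
Implicit Types (mu nu : {measure set T -> \bar R}) (f : T -> R).

(** Extends the scaling rule from nonnegative functions to integrable ones by
splitting into positive and negative parts. *)
Lemma integral_mscale_integrable mu (k : {nonneg R}) (D : set T)
    (f : T -> \bar R) : measurable D -> mu.-integrable D f ->
  (\int[mscale k mu]_(x in D) f x = k%:num%:E * \int[mu]_(x in D) f x)%E.
Proof.
move=> mD intf; have mf := measurable_int _ intf.
have mp := measurable_funepos mf; have mn := measurable_funeneg mf.
rewrite (integralE mu) (integralE (mscale k mu)).
rewrite [X in (X - _)%E]ge0_integral_mscale// [X in (_ - X)%E]ge0_integral_mscale//.
symmetry; apply: muleBr => //; exact: (integrable_add_def mD intf).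
Qed.

Lemma Rintegral_mixture (a : R) (a0 : 0 < a) (a1 : a < 1) mu nu f :
  mu setT = 1%E -> nu setT = 1%E -> bounded_measurable setT f ->
  \int[mixture a0 a1 mu nu]_x f x =
  a * \int[mu]_x f x + (1 - a) * \int[nu]_x f x.
Proof.
move=> mu1 nu1 bf.
have iu : mu.-integrable setT (EFin \o f) by exact: bounded_measurable_integrable.
have iv : nu.-integrable setT (EFin \o f) by exact: bounded_measurable_integrable.
have mf := measurable_int _ iu.
have sc (k : {nonneg R}) (m : {measure set T -> \bar R}) :
    m setT = 1%E -> (mscale k m).-integrable setT (EFin \o f).
  move=> m1; case: bf => mf' [B fB]; apply: measurable_bounded_integrable => //.
    by change (k%:num%:E * m setT < +oo)%E; rewrite m1 mule1 ltry.
  exists B; split; first exact: num_real.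
  by move=> C BC x Dx; exact: le_trans (fB x Dx) (ltW BC).
rewrite /Rintegral /mixture integral_measure_add//; [|exact: sc..].
rewrite !integral_mscale_integrable//.
rewrite fineD ?fineM//; try exact: integrable_fin_num.
- by rewrite fin_numM//; exact: integrable_fin_num.
- by rewrite fin_numM//; exact: integrable_fin_num.
Qed.

Lemma Rintegral_full_measure mu (D : set T) f : measurable D -> mu setT = 1%E ->
  mu D = 1%E -> bounded_measurable setT f ->
  \int[mu]_x f x = \int[mu]_(x in D) f x.
Proof.
move=> mD mu1 muD bf.
have mu0 : mu (~` D) = 0%E.
  have : mu (D `|` ~` D) = (mu D + mu (~` D))%E.
    by rewrite measureU ?setICr//; exact: measurableC.
  rewrite setUv mu1 muD; case: (mu (~` D)) (measure_ge0 mu (~` D)) => //= r.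
  by move=> _ [/eqP]; rewrite addrC -subr_eq subrr => /eqP <-.
rewrite /Rintegral (negligible_integral (measurableC mD))//; last first.
  exact: bounded_measurable_integrable.
by rewrite setTD setCK.
Qed.

(** The entropy of a mixture is the mixture of the entropies plus the entropy of
the two mean squares on a two-point space. *)
Lemma Ent_mixture_le (a : R) (a0 : 0 < a) (a1 : a < 1) mu nu f (D : set T) :
  measurable D -> mu setT = 1%E -> nu setT = 1%E -> nu D = 1%E ->
  bounded_measurable setT f ->
  Ent (mixture a0 a1 mu nu) setT (fun x => f x ^+ 2) <=
  a * Ent mu setT (fun x => f x ^+ 2) +
  (1 - a) * Ent nu D (fun x => f x ^+ 2) +
  a * (1 - a) * log_quotient a *
  (Var mu setT f + Var nu D f + (\int[mu]_x f x - \int[nu]_(x in D) f x) ^+ 2).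
Proof.
move=> mD mu1 nu1 nuD bf.
have bf2 := bounded_measurableX bf.
have bL : bounded_measurable setT (fun x => f x ^+ 2 * ln (f x ^+ 2)).
  by apply: bounded_measurable_mulr_ln => // x _; exact: sqr_ge0.
have bfD : bounded_measurable D f.
  case: bf => mf [B fB]; split; first exact: measurable_funTS.
  by exists B => x _; exact: fB.
have Q0 := log_quotient_gt0 a0 a1.
have gap := sqrt_moment_gap measurableT mD mu1 nuD bf bfD.
rewrite /Ent !Rintegral_mixture// !(Rintegral_full_measure mD nu1 nuD)//.
have k0 : 0 <= a * (1 - a) * log_quotient a by rewrite !mulr_ge0 ?subr_ge0// ltW.
have := ler_wpM2l k0 gap.
set A := \int[mu]_x (f x ^+ 2); set B := \int[nu]_(x in D) (f x ^+ 2).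
have A0 : 0 <= A by apply: Rintegral_ge0 => x _; exact: sqr_ge0.
have B0 : 0 <= B by apply: Rintegral_ge0 => x _; exact: sqr_ge0.
have := two_point_log_sobolev a0 a1 (sqrtr_ge0 A) (sqrtr_ge0 B).
rewrite !sqr_sqrtr//; lra.
Qed.

End mixtures.

(** * Functions of class C^1 on coordinate spaces *)

Section calculus.
Context {R : realType}.

Lemma near_eq_continuous_at (T U : topologicalType) (f g : T -> U) (x : T) :
  (\forall y \near x, f y = g y) -> {for x, continuous f} ->
  {for x, continuous g}.
Proof.
move=> fg cf; have e : f x = g x := nbhs_singleton fg.
change (g @ x --> g x); rewrite -e.
exact: cvg_trans (near_eq_cvg fg) cf.
Qed.

Lemma Ck_subset n k (V W : set 'rV[R]_n) f : W `<=` V -> Ck k V f -> Ck k W f.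
Proof.
elim: k f => [|k IH] f WV [cf df]; split=> //.
- by move=> x /WV; exact: cf.
- by move=> x /WV; exact: cf.
- move=> j; have [dj cj] := df j; split; first by move=> x /WV; exact: dj.
  exact: IH.
Qed.

(** Being of class C^1 is local, and depends only on germs; [W] need not be
open. *)
Lemma Ck1_local n (W : set 'rV[R]_n) (f : 'rV[R]_n -> R) :
  (forall x, W x -> exists (U : set 'rV[R]_n) (g : 'rV[R]_n -> R),
    [/\ open U, U x, Ck 1 U g & forall y, U y -> g y = f y]) ->
  Ck 1 W f.
Proof.
move=> loc; split.
  move=> x /loc[U [g [oU Ux [cg _] gf]]].
  apply: near_eq_continuous_at (cg x Ux).
  by apply: filterS (open_nbhs_nbhs (conj oU Ux)).
move=> j; split.
  move=> x /loc[U [g [oU Ux [_ dg] gf]]].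
  apply: (@near_eq_derivable _ _ _ g) (proj1 (dg j) x Ux).
  by apply: filterS (open_nbhs_nbhs (conj oU Ux)).
split=> // x /loc[U [g [oU Ux [_ dg] gf]]].
apply: near_eq_continuous_at ((proj2 (dg j)).1 x Ux).
apply: filterS (open_nbhs_nbhs (conj oU Ux)) => y Uy.
apply: near_eq_derive.
by apply: filterS (open_nbhs_nbhs (conj oU Uy)).
Qed.

Lemma derive_quotient_shift n (f : 'rV[R]_n -> R) (k : R) (x v : 'rV[R]_n) :
  (fun h : R => h^-1 *: (((fun y => f y + k) \o shift x) (h *: v) - (f x + k))) =
  (fun h : R => h^-1 *: ((f \o shift x) (h *: v) - f x)).
Proof. by apply/funext => h /=; rewrite opprD addrACA subrr addr0. Qed.

Lemma Ck1_shift n (V : set 'rV[R]_n) (f : 'rV[R]_n -> R) (k : R) :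
  Ck 1 V f -> Ck 1 V (fun x => f x + k).
Proof.
move=> [cf df]; split.
  by move=> x Vx; exact: cvgD (cf x Vx) (cvg_cst _).
move=> j; have [dj cj] := df j; split.
  by move=> x Vx; rewrite /derivable derive_quotient_shift; exact: dj.
have -> : (fun x => 'D_(basis_vec j) (fun x => f x + k) x) =
          (fun x => 'D_(basis_vec j) f x) => //.
by apply/funext => x; rewrite /derive derive_quotient_shift.
Qed.

Lemma flatten0_continuous n : continuous (@flatten0 R n).
Proof.
move=> x A /nbhs_ballP[e e0 h]; apply/nbhs_ballP; exists e => // y [_ xy].
apply: h; split=> // i j; rewrite !mxE; case: ifP => _; first exact: ballxx.
exact: xy.
Qed.

Lemma flatten0D n (h : R) (j : 'I_n.+1) (x : 'rV[R]_n.+1) :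
  flatten0 (h *: basis_vec j + x) =
  (if j == 0 then 0 else h *: basis_vec j) + flatten0 x.
Proof.
apply/rowP => k; have [->|j0] := eqVneq j 0; rewrite !mxE /=.
  by case: eqVneq => [_|_]; rewrite ?add0r// mulr0 add0r.
case: eqVneq => [->|//].
by rewrite eq_sym (negbTE j0) mulr0 addr0.
Qed.

(** Along a coordinate direction, the difference quotient of [g \o flatten0] is
either zero or a difference quotient of [g]. Hence composing with the
projection needs no chain rule. *)
Lemma derive_quotient_flatten0 n (g : 'rV[R]_n.+1 -> R) (j : 'I_n.+1) x :
  (fun h : R => h^-1 *: (((g \o flatten0) \o shift x) (h *: basis_vec j)
     - (g \o flatten0) x)) =
  if j == 0 then fun=> 0 else
  (fun h : R => h^-1 *: ((g \o shift (flatten0 x)) (h *: basis_vec j)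
     - g (flatten0 x))).
Proof.
apply/funext => h /=; rewrite flatten0D; case: ifP => // _.
by rewrite add0r subrr scaler0.
Qed.

Lemma Ck1_flatten0 n (V : set 'rV[R]_n.+1) (g : 'rV[R]_n.+1 -> R) :
  Ck 1 V g -> Ck 1 (flatten0 @^-1` V) (g \o flatten0).
Proof.
move=> [cg dg]; split.
  move=> x Vx; apply: continuous_comp; first exact: flatten0_continuous.
  exact: cg.
move=> j; have [dj [cj _]] := dg j; split.
  move=> x Vx; rewrite /derivable derive_quotient_flatten0; case: ifP => j0.
    exact: is_cvg_cst.
  exact: dj.
split => // x Vx.
have -> : (fun x => 'D_(basis_vec j) (g \o flatten0) x) =
    if j == 0 then fun=> 0 else (fun y => 'D_(basis_vec j) g y) \o flatten0.
  apply/funext => y; rewrite /derive derive_quotient_flatten0.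
  by case: ifP => // _; exact: lim_cst.
case: ifP => _; first exact: cst_continuous.
apply: continuous_comp; first exact: flatten0_continuous.
exact: cj.
Qed.

Lemma partial_shift n (j : 'I_n) (f : 'rV[R]_n -> R) (k : R) x :
  partial j (fun y => f y + k) x = partial j f x.
Proof.
rewrite /partial.
by under eq_fun do rewrite opprD addrACA subrr addr0.
Qed.

End calculus.

(** * The manifold and its boundary *)

Section manifold.
Context {R : realType} {n : nat} {M : ptopologicalType}.
Variable X : riemannian_manifold R n M.
Implicit Types (p q : M) (f : M -> R).

(** The boundary is defined with the distinguished chart at each point, but any
chart detects it. *)
Lemma boundary_chart i p : dom X i p ->
  boundary X p <-> phi X i p 0 0 = 0.
Proof.
move=> ip; have pp := chart_atP X p; split.
  exact: boundary_invariant pp ip.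
exact: boundary_invariant ip pp.
Qed.

Lemma flatten0_id (x : 'rV[R]_n.+1) : x 0 0 = 0 -> flatten0 x = x.
Proof.
by move=> x0; apply/rowP => j; rewrite mxE; case: eqP => // ->; rewrite x0.
Qed.

Lemma near_dom i p : dom X i p -> \forall q \near p, dom X i q.
Proof. by move=> ip; apply: open_nbhs_nbhs; split => //; exact: dom_open. Qed.

Lemma boundary_closed : closed (boundary X).
Proof.
rewrite -openC openE => p nbp; have ip := chart_atP X p.
set i := chart_at X p in ip.
have ne0 : phi X i p 0 0 != 0.
  by apply/eqP => e; apply: nbp; apply/(boundary_chart ip).
have c00 : {for p, continuous (fun q => phi X i q 0 0)}.
  apply: (@continuous_comp _ _ _ (phi X i) (fun x => x 0 0)).
    exact: phi_continuous.
  exact: coord_continuous.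
have near0 : \forall q \near p, phi X i q 0 0 != 0 by exact: cvgr_neq0 c00 ne0.
apply: filterS2 (near_dom ip) near0 => q iq qn /(boundary_chart iq) q0.
by rewrite q0 eqxx in qn.
Qed.

Lemma C1_continuous f : C1 X f -> continuous f.
Proof.
move=> cf p; have ip := chart_atP X p; set i := chart_at X p in ip.
have [|V [g [oV Vp [cg _] gf]]] := cf i (phi X i p); first by exists p.
have cgp : {for p, continuous (g \o phi X i)}.
  by apply: continuous_comp; [exact: phi_continuous|exact: cg].
apply: near_eq_continuous_at cgp.
have nV : \forall q \near p, V (phi X i q).
  have cphi : phi X i x @[x --> p] --> phi X i p by exact: phi_continuous ip.
  by apply: (cphi V); exact: open_nbhs_nbhs.
apply: filterS2 (near_dom ip) nV => q iq Vq.
by rewrite /= gf ?phiK//; exists q.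
Qed.

Lemma C1_boundary_continuous f : C1_boundary X f ->
  {within boundary X, continuous f}.
Proof.
move=> cf; apply/subspace_continuousP => p bp.
have ip := chart_atP X p; set i := chart_at X p in ip.
have p0 : phi X i p 0 0 = 0 by exact: (boundary_chart ip).1 bp.
have fp : flatten0 (phi X i p) = phi X i p by exact: flatten0_id.
pose h y := f (phi_inv X i (flatten0 y)).
have ch : {for phi X i p, continuous h}.
  by apply: (cf i).1; rewrite /preimage/= fp; exists p.
have chp : {for p, continuous (h \o phi X i)}.
  by apply: continuous_comp ch; exact: phi_continuous.
have hE q : dom X i q -> boundary X q -> (h \o phi X i) q = f q.
  move=> iq /(boundary_chart iq) q0.
  by rewrite /h /= flatten0_id// phiK.
change (f @ within (boundary X) (nbhs p) --> f p).
rewrite -(hE p ip bp); apply: cvg_trans (cvg_within_filter (boundary X) chp).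
apply: near_eq_cvg; rewrite /within/= near_withinE.
by apply: filterS (near_dom ip) => q iq bq; exact: hE.
Qed.

(** A local C^1 extension of [f] to an open set of the whole coordinate space may
be composed with the projection onto the hyperplane, which maps every point
into the half-space. *)
Lemma C1_C1_boundary f : C1 X f -> C1_boundary X f.
Proof.
move=> cf i; apply: Ck1_local => x Wx.
have [V [g [oV Vx cg gf]]] := cf i _ Wx.
have [V' oV' imE] := chart_image i.
(* the second factor makes the preimage of the chart domain open, because
   [flatten0] takes its values in the half-space *)
exists (flatten0 @^-1` (V `&` V')), (g \o flatten0); split.
- by have /continuousP := @flatten0_continuous R n; apply; exact: openI.
- have : (V' `&` half_space) (flatten0 x) by rewrite -imE.
  by case.
- by apply: Ck1_flatten0; apply: Ck_subset cg => y [].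
- move=> y [Vy V'y]; apply: gf => //; rewrite imE; split=> //.
  by rewrite /half_space/= mxE.
Qed.

Lemma C1_shift f (k : R) : C1 X f -> C1 X (fun p => f p + k).
Proof.
move=> cf i x Wx; have [V [g [oV Vx cg gf]]] := cf i x Wx.
exists V, (fun y => g y + k); split => //; first exact: Ck1_shift.
by move=> y Vy Wy; rewrite gf.
Qed.

Lemma C1_boundary_shift f (k : R) : C1_boundary X f ->
  C1_boundary X (fun p => f p + k).
Proof. by move=> cf i; exact: (Ck1_shift k (cf i)). Qed.

Lemma differential_shift f (k : R) p :
  differential X (fun p => f p + k) p = differential X f p.
Proof.
by apply/rowP => j; rewrite !mxE (partial_shift j (f \o phi_inv X _)).
Qed.

Lemma sqnorm_metric_ge0 p v : 0 <= sqnorm (metric_at X p) v.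
Proof.
rewrite /sqnorm; have [->|v0] := eqVneq v 0; first by rewrite !mul0mx mxE.
exact/ltW/metric_pos/v0/chart_atP.
Qed.

(** A tangent vector of the boundary is a tangent vector of the manifold with
vanishing normal coordinate. *)
Lemma sqnorm_boundary_metric_ge0 p v :
  0 <= sqnorm (boundary_metric_at X p) v.
Proof.
have [w w0 wl] : exists2 w : 'rV[R]_n.+1,
    w 0 0 = 0 & forall k, w 0 (lift 0 k) = v 0 k.
  exists (\row_j oapp (v 0) 0 (unlift 0 j)).
    by rewrite mxE unlift_none.
  by move=> k; rewrite mxE liftK.
suff <- : sqnorm (metric_at X p) w = sqnorm (boundary_metric_at X p) v.
  exact: sqnorm_metric_ge0.
rewrite /sqnorm !mxE big_ord_recl [w^T _ _]mxE w0 mulr0 add0r.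
apply: eq_bigr => j _; rewrite !mxE big_ord_recl w0 mul0r add0r wl.
by congr (_ * _); apply: eq_bigr => k _; rewrite wl !mxE.
Qed.

Variables lamO lamB : probability (borel M) R.

Lemma energy_ge0 f : 0 <= energy X lamO f.
Proof. by apply: Rintegral_ge0 => p _; exact: sqnorm_metric_ge0. Qed.

Lemma energy_tau_ge0 f : 0 <= energy_tau X lamB f.
Proof. by apply: Rintegral_ge0 => p _; exact: sqnorm_boundary_metric_ge0. Qed.

Lemma energy_shift f (k : R) :
  energy X lamO (fun p => f p + k) = energy X lamO f.
Proof.
by apply: eq_Rintegral => p _; rewrite /sqgrad /gradient differential_shift.
Qed.

Lemma energy_tau_shift f (k : R) :
  energy_tau X lamB (fun p => f p + k) = energy_tau X lamB f.
Proof.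
apply: eq_Rintegral => p _.
by rewrite /sqgrad_tau /tangential_gradient /tangential_differential
  differential_shift.
Qed.

Lemma open_borel_measurable (A : set (borel M)) :
  open (A : set M) -> measurable A.
Proof. by move=> oA; exact: sub_sigma_algebra. Qed.

Lemma closed_borel_measurable (A : set (borel M)) :
  closed (A : set M) -> measurable A.
Proof.
by move=> cA; rewrite -[A]setCK; apply: measurableC;
  apply: open_borel_measurable; exact: closed_openC.
Qed.

(** The traces on [D] of preimages of open intervals are traces of open sets, and
[D] itself is closed, hence Borel. *)
Lemma continuous_bounded_measurable (D : set M) f : compact [set: M] ->
  closed D -> {within D, continuous f} ->
  bounded_measurable (D : set (borel M)) (f : borel M -> R).
Proof.
move=> cM cD cf; split.
  move=> mD; apply: (measurability _ (RGenOpens.measurableE R)) => //.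
  move=> _ [_ [a [b ->] <-]].
  have /open_subspaceP[W oW WE] : open (f @^-1` `]a, b[ : set (subspace D)).
    by move/continuousP: cf; apply; exact: interval_open.
  rewrite setIC -WE; apply: measurableI; first exact: open_borel_measurable.
  exact: closed_borel_measurable.
have cptD : compact D by apply: subclosed_compact cD cM _.
have [B [_ fB]] := compact_bounded (continuous_compact cf cptD).
by exists (B + 1) => p Dp; apply: (fB (B + 1)); [rewrite ltrDl|exists p].
Qed.

Lemma C1_bounded_measurable f : compact [set: M] -> C1 X f ->
  bounded_measurable [set: borel M] (f : borel M -> R).
Proof.
move=> cM /C1_continuous cf.
apply: (@continuous_bounded_measurable [set: M] f cM); first exact: closedT.
exact: continuous_subspaceT.
Qed.

Lemma C1_boundary_bounded_measurable f : compact [set: M] -> C1_boundary X f ->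
  bounded_measurable (boundary X : set (borel M)) (f : borel M -> R).
Proof.
move=> cM /C1_boundary_continuous cf.
by apply: continuous_bounded_measurable => //; exact: boundary_closed.
Qed.

(** The normalised measure of any Borel set is that of its trace on the
boundary. *)
Lemma boundary_measure_full :
  is_normalised_boundary_measure X lamB -> lamB (boundary X) = 1%E.
Proof.
move=> [c _ nuE]; have mB := closed_borel_measurable boundary_closed.
have := nuE _ measurableT; rewrite setTI -(setIid (boundary X)).
by rewrite -nuE// probability_setT => ->; rewrite setIid.
Qed.

End manifold.

(** * Proof of the bound *)

(** Reduces an inequality between extended reals, infinite values included, to
real upper bounds. *)
Lemma lee_of_lt_real (R : realType) (x y : \bar R) :
  (forall r : R, (y < r%:E)%E -> (x <= r%:E)%E) -> (x <= y)%E.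
Proof.
case: y => [y||] h; last first.
- case: x h => [x||] h //.
    by have := h (x - 1)%R (ltNyr _); rewrite lee_fin lerBrDr gerDl ler10.
  by have := h 0%R (ltNyr _); rewrite leye_eq.
- by rewrite leey.
apply/lee_addgt0Pr => e e0; rewrite -EFinD; apply: h.
by rewrite lte_fin ltrDl.
Qed.

Lemma lt_affine_shift (R : realType) (L C : \bar R) (e k x r : R) :
  (L + e%:E + k%:E * (C + x%:E) < r%:E)%E ->
  (L + k%:E * C < (r - (e + k * x))%:E)%E.
Proof.
rewrite muleDr ?fin_num_adde_defl// addeACA -EFinM -EFinD => h.
by rewrite EFinB lteBrDr.
Qed.

Theorem proposition4p1 (R : realType) (n : nat) (M : ptopologicalType)
  (X : riemannian_manifold R n M) (dim_ge2 : (2 <= n.+1)%N)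
  (compactM : compact [set: M]) (connectedM : connected [set: M])
  (connectedB : connected (boundary X))
  (lamO lamB : probability (borel M) R)
  (lamO_volume : is_normalised_volume X lamO)
  (lamB_hausdorff : is_normalised_boundary_measure X lamB)
  (K_BO L_BO K1 K2 : R)
  (HK : forall f : M -> R, C1 X f ->
    Var lamB (boundary X) f <= K_BO * energy X lamO f)
  (HL : forall f : M -> R, C1 X f ->
    Ent lamB (boundary X) (fun p => f p ^+ 2) <= L_BO * energy X lamO f)
  (HK12 : forall f : M -> R, C1 X f ->
    (\int[lamO]_p f p - \int[lamB]_(p in boundary X) f p) ^+ 2 <=
      K1 * energy X lamO f + K2 * energy_tau X lamB f)
  (a : R) (a0 : 0 < a) (a1 : a < 1) :
  (L_alpha X lamO lamB a0 a1 <=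
   ereal_inf [set maxe
      (L_Omega X lamO + ((1 - a) / a * s * L_BO)%:E
       + ((1 - a) * log_quotient a)%:E
         * (C_Omega X lamO + (t * K_BO)%:E + K1%:E))
      ((1 - s)%:E * L_boundary X lamB
       + (a * log_quotient a)%:E
         * ((1 - t)%:E * C_boundary X lamB + K2%:E))
    | s in `[0%R, 1%R] & t in `[0%R, 1%R]])%E.
Proof.
have volB := boundary_measure_full lamB_hausdorff.
have mB := closed_borel_measurable (@boundary_closed _ _ _ X).
have b0 : 0 < 1 - a by rewrite subr_gt0.
have Q0 := log_quotient_gt0 a0 a1; set Q := log_quotient a in Q0 *.
apply: le_ereal_inf_tmp => _ [s sI [t tI <-]].
move: sI tI; rewrite /= !in_itv/= => /andP[s0 s1] /andP[t0 t1].
apply: lee_of_lt_real => r; rewrite gt_max => /andP[ltO ltB].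
have k0 : 0 <= (1 - a) * Q by rewrite mulr_ge0// ltW.
have k'0 : 0 <= a * Q * (1 - t) by rewrite !mulr_ge0 ?subr_ge0// ltW.
pose rO := r - ((1 - a) / a * s * L_BO + (1 - a) * Q * (t * K_BO + K1)).
pose rB := r - a * Q * K2.
have boundO f : C1 X f ->
    1 * Ent lamO setT (fun p : borel M => f p ^+ 2) +
    (1 - a) * Q * Var lamO setT (f : borel M -> R) <= rO * energy X lamO f.
  move: f; apply: (@optimal_constants_combination _ (borel M) R lamO setT
    measurableT (probability_setT lamO) (C1 X) (energy X lamO)
    _ _ _ _ 1 ((1 - a) * Q) rO).
  - by move=> g; exact: C1_bounded_measurable.
  - by move=> g k; exact: C1_shift.
  - by move=> g; exact: energy_ge0.
  - by move=> g k; exact: energy_shift.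
  - exact: ler01.
  - exact: k0.
  rewrite mul1e; apply: lt_affine_shift.
  by rewrite EFinD addeA.
have boundB f : C1 X f ->
    (1 - s) * Ent lamB (boundary X) (fun p : borel M => f p ^+ 2) +
    a * Q * (1 - t) * Var lamB (boundary X) (f : borel M -> R) <=
    rB * energy_tau X lamB f.
  move=> /C1_C1_boundary; move: f.
  apply: (@optimal_constants_combination _ (borel M) R lamB (boundary X)
    mB volB (C1_boundary X) (energy_tau X lamB)
    _ _ _ _ (1 - s) (a * Q * (1 - t)) rB).
  - by move=> g; exact: C1_boundary_bounded_measurable.
  - by move=> g k; exact: C1_boundary_shift.
  - by move=> g; exact: energy_tau_ge0.
  - by move=> g k; exact: energy_tau_shift.
  - by rewrite subr_ge0.
  - exact: k'0.
  rewrite EFinM -muleA /rB -[_ * K2]add0r.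
  by apply: lt_affine_shift; rewrite adde0.
apply: ereal_inf_lbound; exists r => // f Cf.
have bf := C1_bounded_measurable compactM Cf.
apply: (le_trans (Ent_mixture_le a0 a1 mB (probability_setT lamO)
  (probability_setT lamB) volB bf)).
have k1 : 0 <= a * (1 - a) * Q by rewrite !mulr_ge0// ltW.
have H1 := ler_wpM2l (ltW a0) (boundO _ Cf).
have H2 := ler_wpM2l (ltW b0) (boundB _ Cf).
have H3 := ler_wpM2l (mulr_ge0 (ltW b0) s0) (HL _ Cf).
have H4 := ler_wpM2l (mulr_ge0 k1 t0) (HK _ Cf).
have H5 := ler_wpM2l k1 (HK12 _ Cf).
rewrite /energy_alpha.
(* the factor [(1 - a) / a] moves the entropy on the boundary into the
   coefficient of [a * energy] *)
have e : a * rO = a * r - (1 - a) * s * L_BO -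
    a * (1 - a) * Q * (t * K_BO + K1).
  by rewrite /rO; field; rewrite gt_eqF.
rewrite mulrA e in H1; rewrite /rB in H2.
move: H1 H2 H3 H4 H5; rewrite -/Q.
set EO := energy X lamO f; set EB := energy_tau X lamB f.
move: (Ent lamO _ _) (Ent lamB _ _) (Var lamO _ _) (Var lamB _ _) (_ ^+ 2).
move=> x1 x2 x3 x4 x5 H1 H2 H3 H4 H5.
lra.
Qed.
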